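(* Let $n\ge 2$, let $X=(X_1,\dots,X_n)$ be a random vector with values in $[0,+\infty[^n$ and law $\mu_X$, and let $\Psi_i:[0,+\infty[^{k_i}\to[0,+\infty[$, $i=1,\dots,n$, $c\in\mathbb R$ and a concave nondecreasing $U:\,]-\infty,c]\to\mathbb R$ be given. If $\mathbb E X_i^{k_i}<\infty$ for $i=1,\dots,n$ and each function $\Psi_i$ is continuous in $$D_{k_i}\cup\left\{x\in[0,+\infty[^{k_i}:\ x_1=x_2^{1/2}=x_3^{1/3}=\cdots=x_{k_i}^{1/k_i}\right\},$$ then the expected utility functional $\rho(\nu)=\mathbb E^\nu U(L_\nu)$ is upper semicontinuous in $\overline{\mathcal H}_X$ and therefore admits a maximizer (in $\overline{\mathcal H}_X$).
   Context: For an array $x=(x_1,\dots,x_n)$, $x_{[i]}=(x_1,\dots,x_{i-1},x_{i+1},\dots,x_n)$. $\mathcal P$ is the space of Borel probability measures on $\mathbb R^{2n}$ with the topology of weak convergence. Coordinates on $\mathbb R^{2n}$ are written $(x,z)=(x_1,\dots,x_n,z_1,\dots,z_n)$, and $X_i,Z_i$ also denote the coordinate maps; $\mathbb E^\nu\varphi=\int\varphi\,d\nu$. $\mathcal H_X$ is the set of all $\nu\in\mathcal P$ such that: (i) the marginal of $\nu$ on the $x$-coordinates is $\mu_X$; (ii) $\nu\{(x,z): 0\le z_i\le x_i,\ i=1,\dots,n\}=1$; (iii) for every $i$, under $\nu$ the variable $Z_i$ is conditionally independent of $(X_{[i]},Z_{[i]})$ given $X_i$. $\overline{\mathcal H}_X$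 is the closure of $\mathcal H_X$ in $\mathcal P$. $D_k=\{x\in\,]0,+\infty[^k: x_1<x_2^{1/2}<\cdots<x_k^{1/k}\}$, and $k_i\ge1$ are integers. The premium for risk $i$ is $P_i(\nu)=\Psi_i(\mathbb E^\nu Z_i,\mathbb E^\nu Z_i^2,\dots,\mathbb E^\nu Z_i^{k_i})$, the net profit is $L_\nu(x,z)=c-\sum_{i=1}^n(P_i(\nu)+x_i-z_i)$ (which is $\le c$ $\nu$-a.s. for $\nu\in\overline{\mathcal H}_X$), and $\rho(\nu)=\mathbb E^\nu U(L_\nu)\in[-\infty,+\infty[$. *)

(* Defs.v *)
From mathcomp Require Import all_boot all_order all_algebra.
From mathcomp Require Import all_classical all_reals all_analysis.

Set Implicit Arguments.
Unset Strict Implicit.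
Unset Printing Implicit Defensive.

Import Order.TTheory GRing.Theory Num.Theory.
Import numFieldNormedType.Exports.

Local Open Scope classical_set_scope.
Local Open Scope ring_scope.

Definition borel_rV (R : realType) (m : nat) :=
  g_sigma_algebraType (@open 'rV[R]_m).

(* Functions [Z] and [W] are conditionally independent given [Y]: for [A] in
   sigma(Z) and [B] in sigma(W), P(A & B | Y) = P(A | Y) P(B | Y) a.s.
   Conditional probabilities are given by their versions, which always exist
   and are a.s. unique, so the choice of versions is immaterial. *)
Definition cond_prob_version (d d' : measure_display) (T : measurableType d)
    (S : measurableType d') (R : realType) (nu : probability T R)
    (Y : T -> S) (A : set T) (g : T -> R) : Prop :=
  [/\ forall C : set R, measurable C -> g_sigma_algebra_preimage Y (g @^-1` C),
      nu.-integrable setT (EFin \o g) &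
      forall B : set T, g_sigma_algebra_preimage Y B ->
        (\int[nu]_(v in B) (g v)%:E = nu (A `&` B))%E].

Definition cond_indep (d d1 d2 d3 : measure_display) (T : measurableType d)
    (S1 : measurableType d1) (S2 : measurableType d2) (S3 : measurableType d3)
    (R : realType) (nu : probability T R)
    (Z : T -> S1) (W : T -> S2) (Y : T -> S3) : Prop :=
  forall A B : set T,
    g_sigma_algebra_preimage Z A -> g_sigma_algebra_preimage W B ->
    exists p q r : T -> R,
      [/\ cond_prob_version nu Y A p, cond_prob_version nu Y B q,
          cond_prob_version nu Y (A `&` B) r &
          {ae nu, forall v, r v = p v * q v}].

Definition bounded_continuous (R : realType) (m : nat) : Type :=
  {h : 'rV[R]_m -> R | continuous h /\ bounded_fun h}.

Definition integrals (R : realType) (m : nat)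
    (nu : probability (borel_rV R m) R) :
    {ptws bounded_continuous R m -> R} :=
  fun h => (\int[nu]_v (sval h (v : 'rV[R]_m)))%R.

(* Borel probability measures on R^m with the topology of weak convergence:
   the coarsest one for which nu |-> \int h dnu is continuous for every bounded
   continuous h. *)
Definition borel_proba (R : realType) (m : nat) : topologicalType :=
  initial_topology (@integrals R m).

Definition upper_semicontinuous (T : topologicalType) (R : numFieldType)
    (f : T -> \bar R) : Prop :=
  forall (x : T) (a : R), (f x < a%:E)%E ->
    exists2 V, nbhs x V & forall y, V y -> (f y < a%:E)%E.

(* A point of R^(2n) is v = (x, z) : 'rV_(n + n). *)
Definition xpart (R : realType) (n : nat) (v : borel_rV R (n + n)) :
  borel_rV R n := lsubmx (v : 'rV[R]_(n + n)).

Definition zpart (R : realType) (n : nat) (v : borel_rV R (n + n)) :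
  borel_rV R n := rsubmx (v : 'rV[R]_(n + n)).

Definition xcoord (R : realType) (n : nat) (i : 'I_n)
  (v : borel_rV R (n + n)) : R := (xpart v : 'rV[R]_n) ord0 i.

Definition zcoord (R : realType) (n : nat) (i : 'I_n)
  (v : borel_rV R (n + n)) : R := (zpart v : 'rV[R]_n) ord0 i.

(* (x_[i], z_[i]) *)
Definition other_coords (R : realType) (n : nat) (i : 'I_n)
    (v : borel_rV R (n + n)) : borel_rV R (n.-1 + n.-1) :=
  row_mx (col' i (xpart v : 'rV[R]_n)) (col' i (zpart v : 'rV[R]_n)).

Definition HX (R : realType) (n : nat) (muX : set (borel_rV R n) -> \bar R) :
    set (borel_proba R (n + n)) :=
  [set nu : probability (borel_rV R (n + n)) R |
    [/\ forall A : set (borel_rV R n), measurable A ->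
          pushforward nu (@xpart R n) A = muX A,
        nu [set v | forall i : 'I_n, 0 <= zcoord i v <= xcoord i v] = 1%E &
        forall i : 'I_n, cond_indep nu (zcoord i) (other_coords i) (xcoord i)]].

(* Index j : 'I_k stands for the (j+1)-st coordinate, so this is
   x_(j+1)^(1/(j+1)). *)
Definition moment_root (R : realType) (k : nat) (x : 'rV[R]_k) (j : 'I_k) : R :=
  x ord0 j `^ (j.+1%:R)^-1.

Definition moment_cone (R : realType) (k : nat) : set 'rV[R]_k :=
  [set x : 'rV[R]_k | (forall j, 0 < x ord0 j) /\
           forall i j : 'I_k, (i < j)%N -> moment_root x i < moment_root x j].

Definition moment_diag (R : realType) (k : nat) : set 'rV[R]_k :=
  [set x : 'rV[R]_k | (forall j, 0 <= x ord0 j) /\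
           forall i j : 'I_k, moment_root x i = moment_root x j].

Definition moments (R : realType) (n : nat) (k : nat) (i : 'I_n)
    (nu : probability (borel_rV R (n + n)) R) : 'rV[R]_k :=
  \row_(j < k) fine 'E_nu[fun v => (zcoord i v ^+ j.+1)%R].

Definition premium (R : realType) (n : nat) (k : 'I_n -> nat)
    (Psi : forall i : 'I_n, 'rV[R]_(k i) -> R) (i : 'I_n)
    (nu : probability (borel_rV R (n + n)) R) : R :=
  Psi i (moments (k i) i nu).

Definition net_profit (R : realType) (n : nat) (k : 'I_n -> nat)
    (Psi : forall i : 'I_n, 'rV[R]_(k i) -> R) (c : R)
    (nu : probability (borel_rV R (n + n)) R) (v : borel_rV R (n + n)) : R :=
  c - \sum_(i < n) (premium Psi i nu + xcoord i v - zcoord i v).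

(* U is only meaningful on ]-oo, c], hence the restriction to L_nu <= c, an
   event of nu-probability 1 when nu is in the closure of H_X. *)
Definition expected_utility (R : realType) (n : nat) (k : 'I_n -> nat)
    (Psi : forall i : 'I_n, 'rV[R]_(k i) -> R) (c : R) (U : R -> R)
    (nu : probability (borel_rV R (n + n)) R) : \bar R :=
  (\int[nu]_(v in [set v | (net_profit Psi c nu v <= c)%R])
     (U (net_profit Psi c nu v))%:E)%E.

Definition concave_function (R : realType) (A : set R^o) (f : R -> R) : Prop :=
  @convex_function R R^o A (fun x => - f x).

(* Main.v *)
Require Import Defs.
From HB Require Import structures.
From mathcomp Require Import all_boot all_order all_algebra.
From mathcomp Require Import all_classical all_reals all_analysis.
From mathcomp Require Import measurable_realfun ring lra.

Set Implicit Arguments.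
Unset Strict Implicit.
Unset Printing Implicit Defensive.

Import Order.TTheory GRing.Theory Num.Theory.
Import numFieldNormedType.Exports.

Local Open Scope classical_set_scope.
Local Open Scope ring_scope.

(** The theorem rests on three facts about the closure of H_X.

    Compactness. Every nu in the closure has the law of X as x-marginal and
    satisfies 0 <= z <= x almost surely, because both constraints can be tested
    by integrals of bounded continuous functions ([HX_closure_dominated]). The
    first moments of X then bound those of all coordinates, so the closure is
    uniformly tight. A closed uniformly tight set is compact
    ([uniformly_tight_compact]): along an ultrafilter the integrals of each
    bounded continuous h converge to a number L h, and a positive linear
    functional L that is tight is integration against a probability measure
    ([tf_represented]). That measure comes from Daniell's construction: the outer
    measure of a set A is the infimum of sup_k L (h_k) over the nondecreasing
    sequences of nonnegative h_k whose supremum is at least 1 on A.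

    Continuity of the premiums. The j-th moment of z_i is within
    E (X_i^j - N)^+ of the integral of the bounded function min (z_i^j, N), and
    this error is the same for all nu because the x-marginal is fixed. Hence
    moments are uniform limits of weakly continuous functions ([moments_cvg]).
    The moment vector of a nonnegative variable lies on the diagonal if the
    variable is almost surely constant; otherwise the L^j norms increase
    strictly with j and it lies in the open cone
    ([moment_vector_cone_or_diag]). So Psi_i is evaluated only where it is
    continuous.

    Semicontinuity. The function y |-> U (min (y, c)) is concave and
    nondecreasing on the whole line, hence continuous, and it is bounded by U c.
    The nonnegative function D y = U c - U (min (y, c)) is continuous and
    nonincreasing, and expected utility equals U c minus the integral of
    D (c - p(nu) - s), with p(nu) the total premium and s = sum_i (x_i - z_i). Near nu0 one
    has p(nu) > p(nu0) - 1/N, so this integral is at least that of the fixed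
    bounded continuous function min (D (c - p(nu0) + 1/N - s), N); by monotone
    convergence the latter comes as close as wanted to the value at nu0
    ([expected_utility_usc]).

    A maximizer exists once H_X is nonempty; the law of (X, 0) belongs to it,
    since a variable that is almost surely constant is conditionally independent
    of everything ([HX_nonempty]). *)

(** * Continuous functions on row vectors *)

Lemma cvg_rV (T : Type) (F : set_system T) (FF : Filter F) (R : realType) (m : nat)
    (f : T -> 'rV[R]_m) (l : 'rV[R]_m) :
  (forall j, (fun x => f x ord0 j) @ F --> l ord0 j) -> f @ F --> l.
Proof.
move=> fl A [P lP sPA]; apply: (@filterS _ F _ (fun x => forall j, P ord0 j (f x ord0 j))).
  by move=> x Px; apply: sPA => i j; rewrite ord1.
by apply: filter_forall => j; apply: fl.
Qed.

Lemma continuous_rV (T : topologicalType) (R : realType) (m : nat)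
    (f : T -> 'rV[R]_m) :
  (forall j, continuous (fun x => f x ord0 j)) -> continuous f.
Proof. by move=> cf x; apply: cvg_rV => j; apply: cf. Qed.

Lemma continuous_measurable_rV (R : realType) (m p : nat)
    (f : 'rV[R]_m -> 'rV[R]_p) :
  continuous f -> measurable_fun setT (f : borel_rV R m -> borel_rV R p).
Proof.
move=> /continuousP cf.
apply: (@measurability _ _ (borel_rV R m) (borel_rV R p) setT f (@open 'rV[R]_p)) => //.
move=> _ [B oB <-]; rewrite setTI; apply: sub_gen_smallest; exact: cf.
Qed.

Lemma continuous_measurable_R (R : realType) (m : nat) (f : 'rV[R]_m -> R) :
  continuous f -> measurable_fun setT (f : borel_rV R m -> R).
Proof.
move=> /continuousP cf.
apply: (measurability _ (RGenOpens.measurableE R)).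
move=> _ [_ [a [b ->] <-]]; rewrite setTI.
apply: sub_gen_smallest; apply: cf; exact: interval_open.
Qed.

Section coordinates.
Context (R : realType) (n : nat).

Lemma xpart_continuous : continuous (fun v : 'rV[R]_(n + n) => lsubmx v).
Proof.
apply: continuous_rV => j.
under eq_fun do rewrite mxE.
exact: coord_continuous.
Qed.

Lemma xcoord_continuous i : continuous (fun v : 'rV[R]_(n + n) => @xcoord R n i v).
Proof.
rewrite /xcoord /xpart; under eq_fun do rewrite mxE.
exact: coord_continuous.
Qed.

Lemma zcoord_continuous i : continuous (fun v : 'rV[R]_(n + n) => @zcoord R n i v).
Proof.
rewrite /zcoord /zpart; under eq_fun do rewrite mxE.
exact: coord_continuous.
Qed.

Lemma measurable_other_coords i : measurable_fun setT (@other_coords R n i).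
Proof.
apply: (@continuous_measurable_rV _ _ _ (fun v : 'rV[R]_(n + n) =>
  row_mx (col' i (lsubmx v)) (col' i (rsubmx v)))).
apply: continuous_rV => j.
rewrite -[j]splitK; case: (fintype.split j) => k /=.
  by under eq_fun do rewrite row_mxEl !mxE; exact: coord_continuous.
by under eq_fun do rewrite row_mxEr !mxE; exact: coord_continuous.
Qed.

End coordinates.

Section continuous_real_functions.
Context (R : realType) (T : topologicalType).
Implicit Types f g : T -> R.

Lemma continuous_minr f g : continuous f -> continuous g ->
  continuous (fun x => Num.min (f x) (g x)).
Proof. by move=> cf cg x; exact: (@continuous_min R T f g x (cf x) (cg x)). Qed.

Lemma continuous_maxr f g : continuous f -> continuous g ->
  continuous (fun x => Num.max (f x) (g x)).
Proof. by move=> cf cg x; exact: (@continuous_max R T f g x (cf x) (cg x)). Qed.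

Lemma continuous_addr f g : continuous f -> continuous g ->
  continuous (fun x => f x + g x).
Proof. by move=> cf cg x; exact: (@continuousD R R^o T f g x (cf x) (cg x)). Qed.

Lemma continuous_mulr f g : continuous f -> continuous g ->
  continuous (fun x => f x * g x).
Proof. by move=> cf cg x; exact: (@continuousM R T f g x (cf x) (cg x)). Qed.

Lemma continuous_oppr f : continuous f -> continuous (fun x => - f x).
Proof. by move=> cf x; exact: (@continuousN R R^o T f x (cf x)). Qed.

Lemma continuous_subr f g : continuous f -> continuous g ->
  continuous (fun x => f x - g x).
Proof. by move=> cf cg; apply: continuous_addr => //; exact: continuous_oppr. Qed.

Lemma continuous_expr f j : continuous f -> continuous (fun x => f x ^+ j).
Proof.
move=> cf; elim: j => [|j ih]; first exact: cst_continuous.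
by under eq_fun do rewrite exprS; exact: continuous_mulr.
Qed.

Lemma continuous_sumr (I : Type) (s : seq I) (F : I -> T -> R) :
  (forall i, continuous (F i)) -> continuous (fun x => \sum_(i <- s) F i x).
Proof.
move=> cF; elim: s => [|i s ih].
  by under eq_fun do rewrite big_nil; exact: cst_continuous.
by under eq_fun do rewrite big_cons; exact: continuous_addr.
Qed.

Lemma continuous_compr f (g : R -> R) : continuous f -> continuous g ->
  continuous (fun x => g (f x)).
Proof. by move=> cf cg x; exact: (@continuous_comp T R R f g x (cf x) (cg _)). Qed.

End continuous_real_functions.

(** * Weak convergence through bounded continuous test functions *)

Section bounded_continuous_functions.
Context (R : realType) (m : nat).
Implicit Types f g h : 'rV[R]_m -> R.

(** A pointwise form of the condition in [bounded_continuous], convenient for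
    closure properties. *)
Definition bcont h := continuous h /\ exists M, forall x, `|h x| <= M.

Lemma bcontW h : bcont h -> continuous h /\ bounded_fun h.
Proof.
move=> [ch [M hM]]; split=> //; exists M; split; first exact: num_real.
move=> N MN x xT; exact: (le_trans (hM x) (ltW MN)).
Qed.

Lemma bcont_sval (h : bounded_continuous R m) : bcont (sval h).
Proof.
case: h => h [ch [M [Mr hM]]]; split=> //=; exists (M + 1) => x.
by apply: hM => //; rewrite ltrDl.
Qed.

Lemma bcont_cst a : bcont (fun=> a).
Proof. by split; [exact: cst_continuous|exists `|a|]. Qed.

Lemma bcontD f g : bcont f -> bcont g -> bcont (fun x => f x + g x).
Proof.
move=> [cf [M fM]] [cg [N gN]]; split.
  exact: continuous_addr.
by exists (M + N) => x; apply: (le_trans (ler_normD _ _)); exact: lerD.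
Qed.

Lemma bcontM f g : bcont f -> bcont g -> bcont (fun x => f x * g x).
Proof.
move=> [cf [M fM]] [cg [N gN]]; split.
  exact: continuous_mulr.
by exists (M * N) => x; rewrite normrM; exact: ler_pM.
Qed.

Lemma bcontN f : bcont f -> bcont (fun x => - f x).
Proof.
move=> [cf [M fM]]; split; first exact: continuous_oppr.
by exists M => x; rewrite normrN.
Qed.

Lemma bcontB f g : bcont f -> bcont g -> bcont (fun x => f x - g x).
Proof. by move=> bf bg; apply: bcontD => //; exact: bcontN. Qed.

Lemma bcontZ a f : bcont f -> bcont (fun x => a * f x).
Proof. by move=> bf; apply: bcontM => //; exact: bcont_cst. Qed.

Lemma bcont_sum (I : Type) (s : seq I) (P : pred I) (F : I -> 'rV[R]_m -> R) :
  (forall i, P i -> bcont (F i)) -> bcont (fun x => \sum_(i <- s | P i) F i x).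
Proof.
move=> bF; elim: s => [|i s ih].
  by under eq_fun do rewrite big_nil; exact: bcont_cst.
under eq_fun do rewrite big_cons.
by case Pi: (P i) => //; apply: bcontD => //; exact: bF.
Qed.

Lemma bcont_btw f a b : continuous f -> (forall x, a <= f x <= b) -> bcont f.
Proof.
move=> cf fab; split=> //; exists (`|a| + `|b|) => x; have /andP[af fb] := fab x.
rewrite ler_norml; apply/andP; split; last first.
  by rewrite (le_trans fb)// (le_trans (ler_norm b))// lerDr.
rewrite (le_trans _ af)// opprD -[leRHS]subr0 lerB//.
by rewrite lerNl -normrN ler_norm.
Qed.

End bounded_continuous_functions.

(** The test function of tightness: it is small on a large ball and equals 1 far
    away, so its integral bounds the mass at infinity. *)
Lemma bcont_min_norm (R : realType) (m : nat) (M : R) : 0 < M ->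
  bcont (fun x : 'rV[R]_m => Num.min 1 (`|x| / M)).
Proof.
move=> M0; apply: (@bcont_btw _ _ _ 0 1).
  apply: continuous_minr; first exact: cst_continuous.
  apply: continuous_mulr; last exact: cst_continuous.
  exact: norm_continuous.
by move=> x; rewrite le_min ler01 divr_ge0//= ?(ltW M0)// ge_min lexx.
Qed.

Lemma Rintegral_eq0_ae d (T : measurableType d) (R : realType)
    (mu : probability T R) (f : T -> R) : mu.-integrable setT (EFin \o f) ->
  (forall v, 0 <= f v) -> \int[mu]_v f v = 0 -> {ae mu, forall v, f v = 0}.
Proof.
move=> intf f0 f00.
have mf := measurable_int _ intf.
have : (\int[mu]_x `|(f x)%:E| = 0)%E.
  under eq_integral do rewrite gee0_abs ?lee_fin//.
  rewrite -[LHS]fineK; first by rewrite [fine _]f00.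
  exact: integrable_fin_num.
move=> /(ae_eq_integral_abs mu measurableT mf).
by apply: filterS => x /(_ Logic.I) [].
Qed.

Section integrals_of_bounded_continuous.
Context (R : realType) (m : nat).
Implicit Types (nu : probability (borel_rV R m) R) (h : 'rV[R]_m -> R).

Lemma bcont_integrable nu h : bcont h ->
  nu.-integrable setT (EFin \o (h : borel_rV R m -> R)).
Proof.
move=> [ch [M hM]].
apply: (@le_integrable _ _ _ _ _ measurableT _ (EFin \o cst M)) => //.
- by apply/measurable_EFinP; exact: continuous_measurable_R.
- by move=> x _ /=; rewrite lee_fin (le_trans (hM x))// ler_norm.
- exact: finite_measure_integrable_cst.
Qed.

Definition bint nu h : R := (\int[nu]_v (h (v : 'rV[R]_m)))%R.

Lemma bintE nu h : bcont h -> (\int[nu]_v (h v)%:E)%E = (bint nu h)%:E.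
Proof.
move=> bh; rewrite /bint /Rintegral fineK//; apply: integrable_fin_num => //.
exact: bcont_integrable.
Qed.

Lemma bintD nu f g : bcont f -> bcont g ->
  bint nu (fun x => f x + g x) = bint nu f + bint nu g.
Proof. by move=> bf bg; apply: RintegralD => //; exact: bcont_integrable. Qed.

Lemma bintZ nu a f : bcont f -> bint nu (fun x => a * f x) = a * bint nu f.
Proof. by move=> bf; apply: RintegralZl => //; exact: bcont_integrable. Qed.

Lemma le_bint nu f g : bcont f -> bcont g -> (forall x, f x <= g x) ->
  bint nu f <= bint nu g.
Proof. by move=> bf bg fg; apply: le_Rintegral => //; exact: bcont_integrable. Qed.

Lemma bint_cst nu a : bint nu (fun=> a) = a.
Proof. by rewrite /bint Rintegral_cst// [X in fine X](@probability_setT _ _ _ nu) mulr1. Qed.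

(** Evaluation at h is a projection of the product topology that the topology
    of [borel_proba] is pulled back from. *)
Lemma bint_continuous h : bcont h ->
  continuous (fun nu : borel_proba R m => bint nu h).
Proof.
move=> bh nu.
pose h' : bounded_continuous R m := exist _ h (bcontW bh).
have ic : (@integrals R m x @[x --> (nu : borel_proba R m)]) -->
   (integrals nu : {ptws bounded_continuous R m -> R}).
  exact: (@initial_continuous _ _ (@integrals R m) nu).
have FF : Filter (@integrals R m x @[x --> (nu : borel_proba R m)]).
  by apply: fmap_filter; exact: (@nbhs_filter (borel_proba R m) nu).
have := (cvg_sup _ _ FF).1 ic h'.
move=> ch A nA; apply: (ch ((fun f : {ptws bounded_continuous R m -> R} => f h') @^-1` A)).
exact: (@initial_continuous _ _
  (fun f : {ptws bounded_continuous R m -> R} => f h') (integrals nu)).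
Qed.

Lemma borel_proba_cvg (F : set_system (borel_proba R m)) (nu : borel_proba R m) :
  Filter F -> (forall h, bcont h -> (fun mu : borel_proba R m => bint mu h) @ F --> bint nu h) ->
  F --> nu.
Proof.
move=> FF Fh.
have Fi : (@integrals R m) @ F --> (integrals nu : {ptws bounded_continuous R m -> R}).
  apply/cvg_sup => h A [_ [[B oB <-] Bnu sBA]]; apply: filterS sBA _.
  apply: (Fh (sval h) (bcont_sval h)); exact: open_nbhs_nbhs.
move=> A [_ [[B oB <-] Bnu sBA]].
apply: filterS sBA _; apply: Fi; exact: open_nbhs_nbhs.
Qed.

End integrals_of_bounded_continuous.

(** * Distance to a set and cutoff functions *)

Lemma lipschitz1_continuous (R : realType) (V : normedModType R) (f : V -> R) :
  (forall x y, f x <= `|x - y| + f y) -> continuous f.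
Proof.
move=> lf x; apply/cvgrPdist_le => e e0; near=> y.
have xy : `|x - y| <= e by near: y; apply: cvgr_dist_le => //; exact: cvg_id.
rewrite ler_norml; apply/andP; split.
  by rewrite lerNl opprB lerBlDr (le_trans (lf y x))// lerD2r distrC.
by rewrite lerBlDr (le_trans (lf x y))// lerD2r.
Unshelve. all: by end_near. Qed.

Section distance.
Context (R : realType) (V : normedModType R).
Implicit Types (C : set V) (x y : V).

Definition dist_to C x : R := inf [set `|x - y| | y in C].

Lemma dist_to_ge0 C x : 0 <= dist_to C x.
Proof.
have [->|/set0P[y Cy]] := eqVneq C set0; first by rewrite /dist_to image_set0 inf0.
by apply: lb_le_inf; [exists `|x - y|, y|move=> _ [z _ <-]].
Qed.

Lemma dist_to0 C x : C x -> dist_to C x = 0.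
Proof.
move=> Cx; apply/eqP; rewrite eq_le dist_to_ge0 andbT; apply: ge_inf.
  by exists 0 => _ [z _ <-].
by exists x => //; rewrite subrr normr0.
Qed.

Lemma dist_to_continuous C : continuous (dist_to C).
Proof.
have [->|/set0P[z0 Cz0]] := eqVneq C set0.
  by rewrite /dist_to => x; under eq_fun do rewrite image_set0; exact: cst_continuous.
apply: lipschitz1_continuous => x y; rewrite -lerBlDl.
apply: lb_le_inf; first by exists `|y - z0|, z0.
move=> _ [z Cz <-]; rewrite lerBlDl.
apply: (@le_trans _ _ `|x - z|); last first.
  by rewrite -[x - z](subrKA y) ler_normD.
by apply: ge_inf; [exists 0 => _ [w _ <-]|exists z].
Qed.

Lemma dist_to_gt0 C x : C !=set0 -> closed C -> ~ C x -> 0 < dist_to C x.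
Proof.
move=> [z0 Cz0] cC nCx.
have [e /= e0 xeC] : exists2 e : R, 0 < e & forall y, `|x - y| < e -> ~ C y.
  have /nbhs_ballP[e e0 xe] : nbhs x (~` C) by apply: open_nbhs_nbhs; split=> //; exact: closed_openC.
  by exists e => // y xye; apply: xe; rewrite -ball_normE.
apply: (lt_le_trans e0); apply: lb_le_inf; first by exists `|x - z0|, z0.
by move=> _ [z Cz <-]; rewrite leNgt; apply/negP => /xeC.
Qed.

End distance.

(** The indicator function of an open set is the limit of a nondecreasing
    sequence of continuous functions. The sequence min (1, k d(x, G^c)) moreover
    reaches its limit at every point of G, which spares a limit argument in
    [open_caratheodory]. *)
Lemma open_cutoff (R : realType) (m : nat) (G : set 'rV[R]_m) : open G ->
  exists chi : nat -> 'rV[R]_m -> R,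
    [/\ forall k, bcont (chi k), forall k x, 0 <= chi k x <= 1,
        forall k x, chi k x <= chi k.+1 x,
        forall x, G x -> exists k, chi k x = 1 &
        forall k x, ~ G x -> chi k x = 0].
Proof.
move=> oG; have [G0|G0] := eqVneq (~` G) set0.
  (* the distance to the empty set is 0 by convention, hence the case split *)
  exists (fun _ _ => 1); split => [k|k x|k x|x _|k x nGx].
  - exact: bcont_cst.
  - by rewrite ler01 lexx.
  - by [].
  - by exists 0%N.
  - by have : (~` G) x by []; rewrite G0.
pose d := dist_to (~` G).
have d0 x : 0 <= d x := dist_to_ge0 _ _.
exists (fun k x => Num.min 1 (k%:R * d x)).
have chi01 k x : 0 <= Num.min 1 (k%:R * d x) <= 1.
  by rewrite le_min ler01 mulr_ge0//= ge_min lexx.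
split=> //.
- move=> k; apply: (bcont_btw _ (chi01 k)).
  apply: continuous_minr; first exact: cst_continuous.
  apply: continuous_mulr; first exact: cst_continuous.
  exact: dist_to_continuous.
- move=> k x; rewrite le_min !ge_min lexx/= orbC -natr1.
  by rewrite ler_wpM2r ?d0// lerDl.
- move=> x Gx; have dx0 : 0 < d x.
    by apply: dist_to_gt0; [exact/set0P|exact: open_closedC|].
  exists (Num.truncn (d x)^-1).+1; apply/min_idPl.
  rewrite -ler_pdivrMr// mul1r.
  exact/ltW/truncnS_gt.
by move=> k x Gx; rewrite /d dist_to0// mulr0 minC; apply/min_idPl.
Qed.

(** * Tight positive functionals are integrals *)

(** Only the values on bounded continuous functions are constrained. Tightness
    replaces the compactness of the space in Riesz representation: without it, a
    limit of Dirac masses that escape to infinity would qualify. *)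
Record tight_functional (R : realType) (m : nat) := TightFunctional {
  tf_fun :> ('rV[R]_m -> R) -> R ;
  tfD : forall f g, bcont f -> bcont g ->
    tf_fun (fun x => f x + g x) = tf_fun f + tf_fun g ;
  tfZ : forall a f, bcont f -> tf_fun (fun x => a * f x) = a * tf_fun f ;
  le_tf : forall f g, bcont f -> bcont g -> (forall x, f x <= g x) ->
    tf_fun f <= tf_fun g ;
  tf1 : tf_fun (fun=> 1) = 1 ;
  tf_tight : forall e, 0 < e ->
    exists2 M, 0 < M & tf_fun (fun x => Num.min 1 (`|x| / M)) <= e }.

Section daniell.
Context (R : realType) (m : nat) (L : tight_functional R m).
Local Notation V := 'rV[R]_m.
Implicit Types (f g : V -> R) (h : nat -> V -> R) (A : set V).

Lemma tf_cst a : L (fun=> a) = a.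
Proof.
have -> : (fun _ : V => a) = (fun _ => a * 1) by apply/funext => x; rewrite mulr1.
by rewrite (tfZ _ _ (bcont_cst _ 1)) tf1 mulr1.
Qed.

Lemma tf_ge0 f : bcont f -> (forall x, 0 <= f x) -> 0 <= L f.
Proof. by move=> bf f0; rewrite -(tf_cst 0); apply: le_tf => //; exact: bcont_cst. Qed.

Lemma tf_sum (I : Type) (s : seq I) (F : I -> V -> R) :
  (forall i, bcont (F i)) -> L (fun x => \sum_(i <- s) F i x) = \sum_(i <- s) L (F i).
Proof.
move=> bF; elim: s => [|i s ih].
  by under eq_fun do rewrite big_nil; rewrite big_nil tf_cst.
under eq_fun do rewrite big_cons.
by rewrite big_cons tfD// ?ih//; apply: bcont_sum.
Qed.

(** The supremum of such a sequence is a lower semicontinuous function that is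
    at least 1 on A. *)
Definition majorizes A h := [/\ forall k, bcont (h k), forall k x, 0 <= h k x,
  forall k x, h k x <= h k.+1 x &
  forall x, A x -> forall e, 0 < e -> exists k, 1 - e <= h k x].

Lemma majorizes_homo A h : majorizes A h ->
  forall x k l, (k <= l)%N -> h k x <= h l x.
Proof. by move=> [_ _ hS _] x; apply: (nondecreasing_seqP (h ^~ x)).1. Qed.

Definition tf_lim h : \bar R := ereal_sup (range (fun k => (L (h k))%:E)).

(** Daniell's upper integral of the indicator function of A. *)
Definition tf_outer A : \bar R := ereal_inf [set tf_lim h | h in majorizes A].

Lemma tf_lim_ub h k : ((L (h k))%:E <= tf_lim h)%E.
Proof. by apply: ereal_sup_ubound; exists k. Qed.

Lemma tf_lim_ge0 A h : majorizes A h -> (0 <= tf_lim h)%E.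
Proof.
move=> [bh h0 _ _]; apply: le_trans (tf_lim_ub h 0).
by rewrite lee_fin tf_ge0.
Qed.

Lemma tf_outer_lb A h : majorizes A h -> (tf_outer A <= tf_lim h)%E.
Proof. by move=> Ah; apply: ereal_inf_lbound; exists h. Qed.

Lemma tf_outer_ge0 A : (0 <= tf_outer A)%E.
Proof. by apply: le_ereal_inf_tmp => _ [h Ah <-]; exact: tf_lim_ge0 Ah. Qed.

Lemma majorizes1 A : majorizes A (fun _ _ => 1).
Proof.
split=> [k|//|//|x _ e e0]; first exact: bcont_cst.
by exists 0%N; rewrite gerBl ltW.
Qed.

Lemma tf_lim_cst a : tf_lim (fun _ _ => a) = a%:E.
Proof.
rewrite /tf_lim (_ : range _ = [set a%:E]) ?ereal_sup1//.
by apply/seteqP; split=> [_ [k _ <-]|_ ->]; [rewrite tf_cst|exists 0%N; rewrite ?tf_cst].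
Qed.

Lemma tf_outer_le1 A : (tf_outer A <= 1)%E.
Proof. by have := tf_outer_lb (majorizes1 A); rewrite tf_lim_cst. Qed.

Lemma tf_outer_fin_num A : tf_outer A \is a fin_num.
Proof.
rewrite ge0_fin_numE ?tf_outer_ge0//; apply: le_lt_trans (tf_outer_le1 A) _.
exact: ltey.
Qed.

Lemma tf_outer0 : tf_outer set0 = 0%E.
Proof.
apply/eqP; rewrite eq_le tf_outer_ge0 andbT -[leRHS](tf_lim_cst 0); apply: tf_outer_lb.
by split=> // k; exact: bcont_cst.
Qed.

Lemma le_tf_outer : {homo tf_outer : A B / A `<=` B >-> (A <= B)%E}.
Proof.
move=> A B AB; apply: le_ereal_inf_tmp => _ [h [bh h0 hS Bh] <-].
by apply: tf_outer_lb; split=> // x /AB; exact: Bh.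
Qed.

(** If h^n majorizes A_n, then the diagonal sums g_k = sum_(n <= k) h^n_k form a
    nondecreasing sequence that majorizes the union, and L g_k is at most the sum
    of the limits of L (h^n). *)
Lemma tf_outer_sigma_subadditive : sigma_subadditive tf_outer.
Proof.
move=> A; apply/lee_addgt0Pr => e e0.
have [H AH] : {H : nat -> nat -> V -> R & forall n, majorizes (A n) (H n) /\
    (tf_lim (H n) <= tf_outer (A n) + (e / (2 ^ n.+1)%:R)%:E)%E}.
  apply: (@choice _ _ (fun n H => majorizes (A n) H /\
    (tf_lim H <= tf_outer (A n) + (e / (2 ^ n.+1)%:R)%:E)%E)) => n.
  have en : 0 < e / (2 ^ n.+1)%:R by rewrite divr_gt0// ltr0n expn_gt0.
  have [_ [h Ah <-] hlt] := lb_ereal_inf_adherent en (tf_outer_fin_num (A n)).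
  by exists h; split=> //; exact: ltW.
apply: le_trans (epsilon_trick _ _ (ltW e0)); last by move=> n; exact: tf_outer_ge0.
pose g k x := \sum_(n < k.+1) H n k x.
have gA : majorizes (\bigcup_n A n) g.
  split.
  - by move=> k; apply: bcont_sum => n _; have [[]] := AH n.
  - by move=> k x; apply: sumr_ge0 => n _; have [[]] := AH n.
  - move=> k x; rewrite /g [leRHS]big_ord_recr/= -[leLHS]addr0; apply: lerD.
      by apply: ler_sum => n _; have [[]] := AH n.
    by have [[]] := AH k.+1.
  - move=> x [n _ Anx] e' e'0; have [An _] := AH n.
    have [k hk] := let: And4 _ _ _ p := An in p x Anx e' e'0.
    exists (maxn n k); apply: (le_trans hk).
    have nk : (n < (maxn n k).+1)%N by rewrite ltnS leq_maxl.
    rewrite /g (bigD1 (Ordinal nk))//= -[leLHS]addr0; apply: lerD.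
      by apply: (majorizes_homo An); rewrite leq_maxr.
    by apply: sumr_ge0 => i _; have [[]] := AH i.
apply: (le_trans (tf_outer_lb gA)); apply: ge_ereal_sup => _ [k _ <-].
rewrite /g tf_sum; last by move=> i; have [[]] := AH i.
rewrite -sumEFin.
apply: (@le_trans _ _ (\sum_(n < k.+1) (tf_outer (A n) + (e / (2 ^ n.+1)%:R)%:E))%E).
  by apply: lee_sum => n _; apply: le_trans (AH n).2; exact: tf_lim_ub.
rewrite -(big_mkord xpredT (fun n => tf_outer (A n) + (e / (2 ^ n.+1)%:R)%:E)%E).
apply: nneseries_lim_ge => n _.
by rewrite adde_ge0 ?tf_outer_ge0// lee_fin divr_ge0 ?ltW// ltr0n expn_gt0.
Qed.

HB.instance Definition _ := isOuterMeasure.Build R V tf_outer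
  tf_outer0 tf_outer_ge0 le_tf_outer tf_outer_sigma_subadditive.

(** For h majorizing A, the sequence h_k chi_k majorizes the intersection with G
    and, for each fixed j, the sequence h_k (1 - chi_j) majorizes the rest. By
    monotonicity L (h_j chi_j) + L (h_k (1 - chi_j)) <= L (h_(max (k, j))), so the
    two suprema add up to at most the limit of L (h_k). *)
Lemma open_caratheodory G : open G -> tf_outer.-caratheodory G.
Proof.
move=> oG; apply: le_caratheodory_measurable => A.
have [chi [bchi chi01 chiS chi1 chi0]] := open_cutoff oG.
apply: le_ereal_inf_tmp => _ [h Ah <-]; have [bh h0 hS hA] := Ah.
have hle := majorizes_homo Ah.
have chile x k l : (k <= l)%N -> chi k x <= chi l x.
  by move: k l; apply: (nondecreasing_seqP (chi ^~ x)).1.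
have chi_ge0 k x : 0 <= chi k x by have /andP[] := chi01 k x.
have chi_le1 k x : chi k x <= 1 by have /andP[] := chi01 k x.
have AG : majorizes (A `&` G) (fun k x => h k x * chi k x).
  split=> [k|k x|k x|x [Ax Gx] e e0].
  - exact: bcontM.
  - exact: mulr_ge0.
  - exact: ler_pM.
  - have [k hk] := hA x Ax e e0; have [l hl] := chi1 x Gx.
    exists (maxn k l).
    have -> : chi (maxn k l) x = 1.
      by apply/le_anti; rewrite chi_le1 -{1}hl chile// leq_maxr.
    by rewrite mulr1 (le_trans hk)// hle// leq_maxl.
have AnG j : majorizes (A `&` ~` G) (fun k x => h k x * (1 - chi j x)).
  split=> [k|k x|k x|x [Ax Gx] e e0].
  - by apply: bcontM => //; apply: bcontB => //; exact: bcont_cst.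
  - by rewrite mulr_ge0// subr_ge0.
  - by rewrite ler_wpM2r// subr_ge0.
  - by have [k hk] := hA x Ax e e0; exists k; rewrite chi0// subr0 mulr1.
have [->|hfin] := eqVneq (tf_lim h) +oo%E; first by rewrite leey.
have {}hfin : tf_lim h \is a fin_num.
  by rewrite ge0_fin_numE ?(tf_lim_ge0 Ah)// lt_neqAle hfin leey.
rewrite -leeBrDr ?tf_outer_fin_num//.
apply: (le_trans (tf_outer_lb AG)); apply: ge_ereal_sup => _ [j _ <-].
rewrite leeBrDr ?tf_outer_fin_num// addeC -leeBrDr//.
apply: (le_trans (tf_outer_lb (AnG j))); apply: ge_ereal_sup => _ [k _ <-].
rewrite leeBrDr// -EFinD; apply: le_trans (tf_lim_ub h (maxn k j)).
have bc1 : bcont (fun x => 1 - chi j x) by apply: bcontB => //; exact: bcont_cst.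
rewrite lee_fin -tfD; [|exact: bcontM..].
apply: le_tf => //; first by apply: bcontD; exact: bcontM.
move=> x; rewrite [leRHS](_ : _ =
  h (maxn k j) x * (1 - chi j x) + h (maxn k j) x * chi j x); last by ring.
by apply: lerD; apply: ler_wpM2r; rewrite ?subr_ge0 ?chi_le1// hle// ?leq_maxl ?leq_maxr.
Qed.

Definition tf_measure : set (borel_rV R m) -> \bar R := tf_outer.

Lemma borel_caratheodory (A : set (borel_rV R m)) :
  measurable A -> tf_outer.-caratheodory A.
Proof.
apply: smallest_sub; last by move=> G; exact: open_caratheodory.
exact: (sigma_algebra_measurable (caratheodory_type tf_outer)).
Qed.

Lemma tf_measure_sigma_additive : semi_sigma_additive tf_measure.
Proof.
move=> A mA tA mUA.
apply: (@caratheodory_measure_sigma_additive R V tf_outer) => //.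
  by move=> i; exact: borel_caratheodory.
exact: borel_caratheodory.
Qed.

HB.instance Definition _ := isMeasure.Build _ (borel_rV R m) R tf_measure
  tf_outer0 tf_outer_ge0 tf_measure_sigma_additive.

(** A variant of Dini's theorem: if h majorizes G, then (f - h_k)^+ decreases to 0,
    uniformly on a large closed ball, while outside of the ball it is at most 1,
    which tightness makes negligible. *)
Lemma tf_le_measure_open (G : set V) f : open G -> bcont f ->
  (forall x, f x <= 1) -> (forall x, ~ G x -> f x <= 0) ->
  ((L f)%:E <= tf_measure G)%E.
Proof.
move=> oG bf f1 f0; apply: le_ereal_inf_tmp => _ [h Gh <-].
have [bh h0 hS hG] := Gh.
apply/lee_addgt0Pr => e e0.
(* half of e for the uniform bound on the ball, half for the mass outside *)
have e20 : 0 < e / 2 by rewrite divr_gt0.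
have [M M0 tM] := tf_tight L e20.
pose K : set V := [set x | `|x| <= M].
have cK : compact K.
  apply: bounded_closed_compact.
    exists M; split; first exact: num_real.
    by move=> N MN x Kx; exact: (le_trans Kx (ltW MN)).
  apply: (@closed_comp _ _ (fun x : V => `|x|) [set r : R | r <= M]).
    by move=> x _; exact: norm_continuous.
  exact: closed_le.
have /compact_near_coveringP cov := cK.
have : \forall k \near \oo, K `<=` (fun x => f x - h k x < e / 2).
  apply: cov => x _.
  have [k fk] : exists k, f x - h k x < e / 2.
    have [Gx|nGx] := pselect (G x).
      have [k hk] := hG x Gx _ (divr_gt0 e20 (@ltr0Sn R 1)).
      exists k; rewrite ltrBlDr; apply: (le_lt_trans (f1 x)).
      move: e20 hk; lra.
    by exists 0%N; have := f0 x nGx; have := h0 0%N x; move: e20; lra.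
  exists ([set y | f y - h k y < e / 2], [set l | (k <= l)%N]).
    split; last by exists k.
    have cfh : continuous (fun y => f y - h k y).
      by apply: continuous_subr; [case: bf|case: (bh k)].
    by have := cfh x [set r | r < e / 2] (lt_nbhsl fk).
  move=> [y l] [/= fy kl]; apply: le_lt_trans fy.
  by rewrite lerD2l lerN2 (majorizes_homo Gh).
case=> k _ /(_ k (leqnn k)) Kfh.
have bmin := bcont_min_norm m M0.
apply: (@le_trans _ _ ((L (h k))%:E + e%:E)%E); last first.
  by apply: leeD => //; exact: tf_lim_ub.
rewrite -EFinD lee_fin.
have bc : bcont (fun _ : V => e / 2) by exact: bcont_cst.
apply: (@le_trans _ _ (L (fun x => h k x + (e / 2 + Num.min 1 (`|x| / M))))).
  apply: le_tf => //; first by do 2 apply: bcontD => //.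
  move=> x; have [xM|Mx] := leP `|x| M.
    have /= := Kfh x xM; rewrite ltrBlDr => /ltW/le_trans; apply.
    rewrite addrC lerD2l lerDl le_min ler01/= divr_ge0//.
    exact: ltW.
  have -> : Num.min 1 (`|x| / M) = 1.
    by apply/min_idPl; rewrite ler_pdivlMr// mul1r ltW.
  by have := f1 x; have := h0 k x; move: e20; lra.
rewrite tfD//; last exact: bcontD.
rewrite tfD// tf_cst; move: tM; lra.
Qed.

Lemma tf_measure_setT : tf_measure setT = 1%E.
Proof.
apply/eqP; rewrite eq_le tf_outer_le1 -(tf1 L).
apply: tf_le_measure_open => //; first exact: openT.
  exact: bcont_cst.
by move=> x /(_ Logic.I).
Qed.

HB.instance Definition _ := Measure_isProbability.Build _ (borel_rV R m) R
  tf_measure tf_measure_setT.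

End daniell.

(** The layers of height 1 of a nonnegative number: this cuts a bounded function
    into functions with values in [0, 1]. *)
Lemma sum_clamp (R : realType) (t : R) N : 0 <= t ->
  \sum_(k < N) Num.max 0 (Num.min 1 (t - k%:R)) = Num.min t N%:R.
Proof.
move=> t0; elim: N => [|N ih]; first by rewrite big_ord0 minC; apply/esym/min_idPl.
rewrite big_ord_recr/= ih -natr1.
have [tN|Nt] := leP t N%:R.
  have -> : Num.max 0 (Num.min 1 (t - N%:R)) = 0.
    by apply/max_idPl; rewrite ge_min subr_le0 tN orbT.
  by rewrite addr0; apply/esym/min_idPl; rewrite (le_trans tN)// lerDl.
have [tN1|N1t] := leP t (N%:R + 1).
  rewrite (_ : Num.min 1 _ = t - N%:R); last by apply/min_idPr; lra.
  by rewrite (_ : Num.max 0 _ = t - N%:R); [lra|apply/max_idPr; lra].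
rewrite (_ : Num.min 1 _ = 1); last by apply/min_idPl; lra.
by rewrite (_ : Num.max 0 _ = 1)//; apply/max_idPr.
Qed.

Section representation.
Context (R : realType) (m : nat).
Local Notation V := 'rV[R]_m.
Implicit Types (nu : probability (borel_rV R m) R) (f : V -> R).

Lemma bint_sum (I : Type) (s : seq I) nu (F : I -> V -> R) :
  (forall i, bcont (F i)) ->
  bint nu (fun x => \sum_(i <- s) F i x) = \sum_(i <- s) bint nu (F i).
Proof.
move=> bF; elim: s => [|i s ih].
  by under eq_fun do rewrite big_nil; rewrite big_nil bint_cst.
under eq_fun do rewrite big_cons.
by rewrite big_cons bintD// ?ih//; apply: bcont_sum.
Qed.

Lemma open_le_bint nu (G : set V) f : open G -> bcont f ->
  (forall x, 0 <= f x) -> (forall x, G x -> 1 <= f x) -> (nu G <= (bint nu f)%:E)%E.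
Proof.
move=> oG bf f0 f1.
have mG : measurable (G : set (borel_rV R m)) by exact: sub_gen_smallest.
rewrite -(setIT (G : set (borel_rV R m))) -integral_indic// -bintE//.
apply: ge0_le_integral => //.
- by apply/measurable_EFinP; exact: measurable_indic.
- by apply/measurable_EFinP; apply: continuous_measurable_R; case: bf.
- move=> x _; rewrite lee_fin indicE.
  by case: (boolP (x \in G)) => //; rewrite inE => /f1.
Qed.

(** Cut N f into the layers psi_k = min (1, (N f - k)^+), for k < N. Each psi_k
    lies below the indicator function of the open set where N f > k, and this
    indicator function lies below the k-th layer of N f + 1. Summation gives
    N L f <= N (int f) + 1 for all N. *)
Lemma tf_le_bint (L : tight_functional R m) f : bcont f ->
  (forall x, 0 <= f x <= 1) -> L f <= bint (tf_measure L) f.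
Proof.
move=> bf f01; have f0 x : 0 <= f x by have /andP[] := f01 x.
have f1 x : f x <= 1 by have /andP[] := f01 x.
pose psi (g : V -> R) k x := Num.max 0 (Num.min 1 (g x - k%:R)).
have psi01 g k x : 0 <= psi g k x <= 1.
  by rewrite /psi le_max lexx ge_max ler01 ge_min lexx.
have bpsi g k : bcont g -> bcont (psi g k).
  move=> [cg _]; apply: (bcont_btw _ (psi01 g k)).
  apply: continuous_maxr; first exact: cst_continuous.
  apply: continuous_minr; first exact: cst_continuous.
  by apply: continuous_subr => //; exact: cst_continuous.
suff H N : N%:R * L f <= N%:R * bint (tf_measure L) f + 1.
  apply/ler_addgt0Pr => e e0.
  have := H (Num.truncn e^-1).+1.
  have := truncnS_gt e^-1; set N := (_.+1) => eN.
  have N0 : 0 < N%:R :> R by rewrite ltr0n.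
  have : 1 <= N%:R * e by rewrite -ler_pdivrMr// mul1r ltW.
  move=> Ne HN; rewrite -(ler_pM2l N0) mulrDr (le_trans HN)// lerD2l//.
have bNf : bcont (fun x => N%:R * f x) by exact: bcontZ.
have bNf1 : bcont (fun x => N%:R * f x + 1) by apply: bcontD => //; exact: bcont_cst.
have Nf0 x : 0 <= N%:R * f x by rewrite mulr_ge0.
rewrite -(tfZ L _ bf) -(bintZ _ _ bf) -[X in _ + X](bint_cst (tf_measure L)).
rewrite -bintD//; last exact: bcont_cst.
have -> : (fun x => N%:R * f x) = (fun x => \sum_(k < N) psi (fun x => N%:R * f x) k x).
  apply/funext => x; rewrite sum_clamp//; apply/esym/min_idPl.
  by rewrite ler_piMr.
rewrite tf_sum; last by move=> k; exact: bpsi.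
apply: (@le_trans _ _ (bint (tf_measure L)
    (fun x => \sum_(k < N) psi (fun x => N%:R * f x + 1) k x))); last first.
  apply: le_bint => //; first by apply: bcont_sum => k _; exact: bpsi.
  by move=> x; rewrite sum_clamp ?addr_ge0// ge_min lexx.
rewrite bint_sum; last by move=> k; exact: bpsi.
apply: ler_sum => k _; rewrite -lee_fin.
pose G : set V := [set x | k%:R < N%:R * f x].
have oG : open G.
  apply: (@open_comp _ _ (fun x : V => N%:R * f x) [set r : R | k%:R < r]).
    by move=> x _; case: bNf => + _; apply.
  exact: open_gt.
apply: (@le_trans _ _ (tf_measure L G)).
  apply: tf_le_measure_open => //; first exact: bpsi.
    by move=> x; have /andP[] := psi01 (fun x => N%:R * f x) k x.
  by move=> x /negP; rewrite -leNgt => xk; rewrite /psi ge_max lexx ge_min subr_le0 xk orbT.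
apply: open_le_bint => //; first exact: bpsi.
  by move=> x; have /andP[] := psi01 (fun x => N%:R * f x + 1) k x.
move=> x; rewrite /G/= => Gx; rewrite /psi le_max le_min lexx/=; apply/orP; right.
by rewrite lerBrDr addrC lerD2r ltW.
Qed.

(** One inequality applied to both f and - f, after an affine rescaling to
    values in [0, 1]. *)
Theorem tf_represented (L : tight_functional R m) f : bcont f ->
  bint (tf_measure L) f = L f.
Proof.
move=> bf; have [cf [M0 fM0]] := bf.
pose M := M0 + 1.
have M00 : 0 <= M0 := le_trans (normr_ge0 _) (fM0 0).
have M_gt0 : 0 < M by rewrite ltr_wpDl.
have fM x : - M <= f x <= M.
  by rewrite -ler_norml (le_trans (fM0 x))// lerDl.
have le g : bcont g -> (forall x, - M <= g x <= M) -> L g <= bint (tf_measure L) g.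
  move=> bg gM; pose g' x := (2 * M)^-1 * (g x + M).
  have bgM : bcont (fun x => g x + M) by apply: bcontD => //; exact: bcont_cst.
  have bg' : bcont g' by exact: bcontZ.
  have M20 : 0 < 2 * M by rewrite mulr_gt0.
  have := tf_le_bint L bg'; rewrite /g' tfZ// bintZ// tfD//; last exact: bcont_cst.
  rewrite bintD//; last exact: bcont_cst.
  rewrite tf_cst bint_cst ler_pM2l ?invr_gt0// lerD2r; apply=> x.
  have /andP[gM1 gM2] := gM x.
  rewrite mulr_ge0 ?invr_ge0 ?(ltW M20)//=; last by rewrite -lerBlDr sub0r.
  rewrite mulrC ler_pdivrMr// mul1r; lra.
apply/eqP; rewrite eq_le le// andbT.
have bNf := bcontZ (-1) bf.
have := le _ bNf; rewrite tfZ// bintZ// !mulN1r lerN2; apply=> x.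
have /andP[fM1 fM2] := fM x; rewrite mulN1r; lra.
Qed.

End representation.

(** * Compactness of uniformly tight closed sets *)

(** A cluster point of an ultrafilter is its limit. *)
Lemma ultra_bounded_cvg (R : realType) (T : Type) (F : set_system T)
    (f : T -> R) (M : R) :
  UltraFilter F -> (forall x, `|f x| <= M) -> cvg (f @ F).
Proof.
move=> FU fM.
have FP : ProperFilter (f @ F) by apply: fmap_proper_filter; exact: ultra_proper.
have FM : (f @ F) `[- M, M]%classic.
  have UP := @ultra_proper _ F FU; apply: (@filterE _ F) => y.
  by rewrite /= in_itv/= -ler_norml.
have [p [_ clp]] := @segment_compact R (- M) M _ FP FM.
apply/cvg_ex; exists p => B pB.
have [//|FnB] := in_ultra_setVsetC (f @^-1` B) FU.
by have [y []] := clp (~` B) B FnB pB.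
Qed.

Definition uniformly_tight (R : realType) (m : nat) (A : set (borel_proba R m)) :=
  forall e, 0 < e -> exists2 M, 0 < M &
    forall nu, A nu -> bint nu (fun x => Num.min 1 (`|x| / M)) <= e.

Section prokhorov.
Context (R : realType) (m : nat).
Implicit Types (f g : 'rV[R]_m -> R) (A : set (borel_proba R m)).

Lemma bint_ultra_cvg (F : set_system (borel_proba R m)) f : UltraFilter F ->
  bcont f -> cvg ((fun nu : borel_proba R m => bint nu f) @ F).
Proof.
move=> FU bf; have [_ [M fM]] := bf; apply: (@ultra_bounded_cvg _ _ _ _ M) => nu.
have bcst a : bcont (fun _ : 'rV[R]_m => a) by exact: bcont_cst.
rewrite ler_norml; apply/andP; split.
  rewrite -(bint_cst nu (- M)); apply: le_bint => // x.
  by have := fM x; rewrite ler_norml => /andP[].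
rewrite -[leRHS](bint_cst nu M).
by apply: le_bint => // x; have := fM x; rewrite ler_norml => /andP[].
Qed.

(** The half of Prokhorov's theorem that gives compactness, with ultrafilters in
    place of subsequences. *)
Lemma uniformly_tight_compact A : closed A -> uniformly_tight A -> compact A.
Proof.
move=> cA tA; rewrite compact_ultra => F FU FA.
have FP : ProperFilter F by exact: ultra_proper.
pose L f := lim ((fun nu : borel_proba R m => bint nu f) @ F).
have cL f : bcont f -> (fun nu : borel_proba R m => bint nu f) @ F --> L f.
  by move=> bf; exact: bint_ultra_cvg.
have LD f g : bcont f -> bcont g -> L (fun x => f x + g x) = L f + L g.
  move=> bf bg; apply/cvg_lim => //.
  under eq_fun do rewrite bintD//.
  by apply: cvgD; exact: cL.
have LZ a f : bcont f -> L (fun x => a * f x) = a * L f.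
  move=> bf; apply/cvg_lim => //.
  under eq_fun do rewrite bintZ//.
  by apply: cvgM; [exact: cvg_cst|exact: cL].
have Lle f g : bcont f -> bcont g -> (forall x, f x <= g x) -> L f <= L g.
  move=> bf bg fg; apply: ler_lim; [exact: bint_ultra_cvg..|].
  by apply: nearW => nu; exact: le_bint.
have L1 : L (fun=> 1) = 1.
  apply/cvg_lim => //; under eq_fun do rewrite bint_cst; exact: cvg_cst.
have Lt e : 0 < e -> exists2 M, 0 < M & L (fun x => Num.min 1 (`|x| / M)) <= e.
  move=> /tA[M M0 AM]; exists M => //; apply: limr_le.
    by apply: bint_ultra_cvg; exact: bcont_min_norm.
  by apply: filterS FA => nu; exact: AM.
pose nu : borel_proba R m := tf_measure (TightFunctional LD LZ Lle L1 Lt).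
have Fnu : F --> nu.
  apply: borel_proba_cvg => f bf.
  by rewrite (tf_represented (TightFunctional LD LZ Lle L1 Lt) bf); exact: cL.
by exists nu; split=> //=; apply: (@closed_cvg _ _ F FP id A cA).
Qed.

End prokhorov.

(** * Maximum of an upper semicontinuous function *)

(** If no point of A were a maximizer, then every x in A would have a neighborhood
    where f stays below the value at some y in A. The sets of points of A with
    value at least f y form a filter base, and a single member of it would work
    for all x in A by compactness: some y would satisfy f y < f y. *)
Lemma usc_compact_max (R : realType) (T : topologicalType) (A : set T)
    (f : T -> \bar R) : compact A -> A !=set0 ->
  upper_semicontinuous (f : subspace A -> \bar R) ->
  exists2 x, A x & forall y, A y -> (f y <= f x)%E.
Proof.
move=> cA [a0 Aa0] uf; apply: contrapT => nmax.
have up x : A x -> exists2 y, A y & (f x < f y)%E.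
  move=> Ax; apply: contrapT => ny; apply: nmax; exists x => // y Ay.
  by rewrite leNgt; apply/negP => xy; apply: ny; exists y.
pose F := filter_from A (fun y0 => [set y | A y /\ (f y0 <= f y)%E]).
have FF : Filter F.
  apply: filter_from_filter; first by exists a0.
  move=> y z Ay Az; have [yz|/ltW zy] := leP (f y) (f z).
    by exists z => // w [Aw zw]; split; split=> //; exact: le_trans zw.
  by exists y => // w [Aw zw]; split; split=> //; exact: le_trans zw.
have /compact_near_coveringP/near_covering_withinP cov := cA.
have : \forall y \near F, A `<=` (fun x => (f x < f y)%E).
  apply: cov => x Ax; have [y Ay xy] := up x Ax.
  have [a xa ay] : exists2 a : R, (f x < a%:E)%E & (a%:E <= f y)%E.
    case: (f x) (f y) xy => [r| |] [t| |]//= xy; first by exists t.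
    - by exists (r + 1); rewrite ?leey// lte_fin ltrDl.
    - by exists t; rewrite ?lexx// ltNyr.
    - by exists 0; rewrite ?ltNyr ?leey.
  have [V xV Va] := uf x a xa.
  have {}xV : within A (nbhs x) V by rewrite nbhs_subspace_in.
  exists (fun z => A z -> V z, [set w | A w /\ (f y <= f w)%E]).
    by split=> //; exists y.
  move=> [z w] [/= zV [Aw yw]] Az.
  by apply: lt_le_trans yw; apply: lt_le_trans ay; exact/Va/zV.
case=> y Ay /(_ y); rewrite /= => /(_ (conj Ay (lexx _))) /(_ y Ay).
by rewrite ltxx.
Qed.

(** * Couplings in the closure of H_X *)

Lemma integral_min_nat_cvg d (T : measurableType d) (R : realType)
    (mu : {measure set T -> \bar R}) (f : T -> R) :
  measurable_fun setT f -> (forall x, 0 <= f x) ->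
  (\int[mu]_x (Num.min (f x) N%:R)%:E)%E @[N --> \oo] --> (\int[mu]_x (f x)%:E)%E.
Proof.
move=> mf f0.
pose g N x : \bar R := (Num.min (f x) N%:R)%:E.
have -> : (\int[mu]_x (f x)%:E)%E = (\int[mu]_x limn (g ^~ x))%E.
  apply: eq_integral => x _; apply/esym/cvg_lim => //.
  apply: (@cvg_near_cst _ _ ); exists (Num.truncn (f x)).+1 => // N /= fN.
  rewrite /g; congr (_%:E); apply/min_idPl/ltW.
  by apply: (lt_le_trans (truncnS_gt _)); rewrite ler_nat.
apply: cvg_monotone_convergence => //.
- move=> N; apply/measurable_EFinP; apply: measurable_minr => //.
- by move=> N x _; rewrite lee_fin le_min f0/=.
- move=> x _ M N MN; rewrite lee_fin le_min ge_min lexx/= ge_min ler_nat MN orbT//.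
Qed.

Section closure.
Context (R : realType) (m : nat).

Lemma bint_closure (E : set (borel_proba R m)) (f : 'rV[R]_m -> R) (a : R) :
  bcont f -> (forall nu, E nu -> bint nu f = a) ->
  forall nu, closure E nu -> bint nu f = a.
Proof.
move=> bf Ea nu cEnu.
have cA : closed [set nu : borel_proba R m | bint nu f = a].
  apply: (@closed_comp _ _ (fun nu : borel_proba R m => bint nu f) [set a]).
    by move=> ? _; exact: bint_continuous.
  exact: closed_eq.
have := closure_subset Ea cEnu.
by rewrite -((closure_id _).1 cA).
Qed.

Lemma bint_eq0_ae (nu : probability (borel_rV R m) R) (f : 'rV[R]_m -> R) :
  bcont f -> (forall x, 0 <= f x) -> bint nu f = 0 ->
  {ae nu, forall x : borel_rV R m, f x = 0}.
Proof. by move=> bf f0; apply: Rintegral_eq0_ae => //; exact: bcont_integrable. Qed.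

Lemma ae_eq0_bint (nu : probability (borel_rV R m) R) (f : 'rV[R]_m -> R) :
  bcont f -> {ae nu, forall x : borel_rV R m, f x = 0} -> bint nu f = 0.
Proof.
move=> bf nuf; have mf : measurable_fun [set: borel_rV R m] (EFin \o f).
  by apply/measurable_EFinP; apply: continuous_measurable_R; case: bf.
have nuf' : {ae nu, forall x : borel_rV R m, setT x -> (EFin \o f) x = cst 0%E x}.
  by apply: filterS nuf => x /= -> _.
by rewrite /bint /Rintegral (ae_eq_integral _ _ _ _ _ nuf')// integral0.
Qed.

End closure.

Section couplings.
Context (R : realType) (n : nat) (d : measure_display) (Omega : measurableType d)
  (P : probability Omega R) (X : {RV P >-> borel_rV R n}).
Implicit Types (nu : probability (borel_rV R (n + n)) R) (i : 'I_n).

(** What survives the closure: conditional independence does not, but the fixed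
    x-marginal and the constraint 0 <= z <= x do. The marginal is only tested on
    nonnegative continuous functions, possibly with infinite integral. *)
Definition dominated_coupling nu :=
  (forall h : 'rV[R]_n -> R, continuous h -> (forall x, 0 <= h x) ->
    (\int[nu]_v (h (xpart v))%:E = \int[P]_w (h (X w))%:E)%E) /\
  {ae nu, forall v, forall i, 0 <= zcoord i v <= xcoord i v}.

(** The integral of min (1, order_defect) vanishes if and only if 0 <= z <= x
    almost surely, and this condition is closed. *)
Definition order_defect (v : 'rV[R]_(n + n)) : R :=
  \sum_(i < n) (Num.max 0 (- zcoord i v) + Num.max 0 (zcoord i v - xcoord i v)).

Lemma order_defect_ge0 v : 0 <= order_defect v.
Proof. by apply: sumr_ge0 => i _; rewrite addr_ge0// le_max lexx. Qed.

Lemma order_defect_continuous : continuous order_defect.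
Proof.
apply: continuous_sumr => i; apply: continuous_addr; apply: continuous_maxr.
- exact: cst_continuous.
- by apply: continuous_oppr; exact: zcoord_continuous.
- exact: cst_continuous.
- by apply: continuous_subr; [exact: zcoord_continuous|exact: xcoord_continuous].
Qed.

Lemma order_defect_eq0 v :
  order_defect v = 0 <-> forall i, 0 <= zcoord i v <= xcoord i v.
Proof.
split=> [v0 i|zx]; last first.
  rewrite /order_defect big1// => i _; have /andP[z0 zx'] := zx i.
  by rewrite (max_idPl _) ?oppr_le0// (max_idPl _) ?subr_le0// addr0.
have := v0; move=> /eqP; rewrite psumr_eq0; last first.
  by move=> j _; rewrite addr_ge0// le_max lexx.
move=> /allP/(_ i); rewrite mem_index_enum => /(_ isT)/implyP/(_ isT).
rewrite paddr_eq0 ?le_max ?lexx// => /andP[/eqP z0 /eqP zx].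
apply/andP; split.
  by rewrite -oppr_le0 -z0 le_max lexx orbT.
by rewrite -subr_le0 -zx le_max lexx orbT.
Qed.

Lemma measurable_xcoord i : measurable_fun setT (@xcoord R n i).
Proof. by apply: (@continuous_measurable_R _ _ (@xcoord R n i)); exact: xcoord_continuous. Qed.

Lemma measurable_zcoord i : measurable_fun setT (@zcoord R n i).
Proof. by apply: (@continuous_measurable_R _ _ (@zcoord R n i)); exact: zcoord_continuous. Qed.

Lemma measurable_xpart : measurable_fun setT (@xpart R n).
Proof.
by apply: (@continuous_measurable_rV _ _ _ (fun v : 'rV[R]_(n + n) => lsubmx v));
  exact: xpart_continuous.
Qed.

Lemma measurable_order_constraint :
  measurable [set v : borel_rV R (n + n) | forall i, 0 <= zcoord i v <= xcoord i v].
Proof.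
rewrite (_ : [set v | _] = order_defect @^-1` [set 0]).
  rewrite -[X in measurable X]setTI.
  by apply: (continuous_measurable_R order_defect_continuous).
by apply/seteqP; split=> v /= /order_defect_eq0.
Qed.

Let bdefect := fun v : 'rV[R]_(n + n) => Num.min 1 (order_defect v).

Lemma bcont_bdefect : bcont bdefect.
Proof.
apply: (@bcont_btw _ _ _ 0 1).
  by apply: continuous_minr; [exact: cst_continuous|exact: order_defect_continuous].
by move=> v; rewrite le_min ler01 order_defect_ge0/= ge_min lexx.
Qed.

Lemma HX_marginal nu (h : borel_rV R n -> \bar R) : HX (distribution P X) nu ->
  measurable_fun setT h -> (forall x, 0 <= h x)%E ->
  (\int[nu]_v h (xpart v) = \int[P]_w h (X w))%E.
Proof.
move=> [muX _ _] mh h0.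
have <- := @ge0_integral_pushforward _ _ _ _ _ _ measurable_xpart nu setT h
  measurableT mh (fun x _ => h0 x).
have <- := @ge0_integral_pushforward _ _ _ _ _ _ (measurable_funP X) P setT h
  measurableT mh (fun x _ => h0 x).
apply: eq_measure_integral; first exact: measurable_xpart.
by move=> mx A mA _; exact: muX.
Qed.

(** For bounded test functions both properties are equalities of integrals, which
    pass to the closure; truncation at N and monotone convergence extend the first
    one to unbounded functions. *)
Lemma HX_closure_dominated nu :
  closure (HX (distribution P X)) nu -> dominated_coupling nu.
Proof.
move=> cnu; split.
  move=> h ch h0.
  have mh : measurable_fun setT (h : borel_rV R n -> R) by exact: continuous_measurable_R.
  have mhx : measurable_fun setT (fun v : borel_rV R (n + n) => h (xpart v)).
    by apply: (measurableT_comp mh); exact: measurable_xpart.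
  have mhX : measurable_fun setT (fun w => h (X w)).
    by apply: (measurableT_comp mh); exact: measurable_funP.
  have c1 := integral_min_nat_cvg (mu := nu) mhx (fun v => h0 (xpart v)).
  have c2 := integral_min_nat_cvg (mu := P) mhX (fun w => h0 (X w)).
  rewrite -(cvg_lim _ c1)// -(cvg_lim _ c2)//; congr (limn _); apply/funext => N.
  pose g (v : 'rV[R]_(n + n)) := Num.min (h (lsubmx v)) N%:R.
  have bg : bcont g.
    apply: (@bcont_btw _ _ _ 0 N%:R).
      apply: continuous_minr; last exact: cst_continuous.
      by move=> v; apply: continuous_comp; [exact: xpart_continuous|exact: ch].
    by move=> v; rewrite le_min h0 ler0n ge_min lexx orbT.
  rewrite [LHS](bintE nu bg).
  pose hN := fun x : borel_rV R n => (Num.min (h x) N%:R)%:E.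
  have mhN : measurable_fun setT hN.
    by apply/measurable_EFinP; apply: measurable_minr.
  have hN0 x : (0 <= hN x)%E by rewrite lee_fin le_min h0/=.
  have HXg nu' : HX (distribution P X) nu' -> (bint nu' g)%:E = (\int[P]_x hN (X x))%E.
    by move=> Hnu'; rewrite -(HX_marginal Hnu' mhN hN0) -bintE.
  have hNfin : (\int[P]_x hN (X x))%E \is a fin_num.
    have [nu' [Hnu' _]] := cnu _ filterT.
    by rewrite -(HXg _ Hnu').
  rewrite -[RHS]fineK//; congr (_%:E).
  apply: (@bint_closure _ _ (HX (distribution P X))) => // nu' Hnu'.
  by rewrite -(HXg _ Hnu').
have : bint nu bdefect = 0.
  apply: (@bint_closure _ _ (HX (distribution P X))) => //; first exact: bcont_bdefect.
  move=> nu' [_ nu'1 _]; apply: ae_eq0_bint; first exact: bcont_bdefect.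
  exists (~` [set v | forall i, 0 <= zcoord i v <= xcoord i v]); split.
  - by apply: measurableC; exact: measurable_order_constraint.
  - rewrite [LHS]probability_setC; last exact: measurable_order_constraint.
    by rewrite nu'1 subee.
  - move=> v /= nv zx; apply: nv; rewrite /bdefect (order_defect_eq0 v).2//.
    by apply/min_idPr.
move=> /(bint_eq0_ae bcont_bdefect) ae0.
apply: filterS (ae0 _) => [v v0|v]; last first.
  by rewrite le_min ler01 order_defect_ge0.
apply/order_defect_eq0; move: v0; rewrite /bdefect.
by case: (leP 1 (order_defect v)) => // _ /eqP; rewrite oner_eq0.
Qed.

End couplings.

(** * Moment vectors of a nonnegative variable *)

(** The weighted inequality of arithmetic and geometric means for t^(j+1) and
    c^(j+1), with a lower bound on its gap that shows when it is strict. With p_j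
    the right-hand side, p_(j+1) - t p_j = (t^(j+1) - c^(j+1)) (t - c) >= 0 and
    p_0 = 0. *)
Lemma amgm_gap (R : realDomainType) (t c : R) j : (1 <= j)%N -> 0 <= t -> 0 <= c ->
  (t ^+ j - c ^+ j) * (t - c) <= j%:R * t ^+ j.+1 - j.+1%:R * c * t ^+ j + c ^+ j.+1.
Proof.
move=> + t0 c0.
have mono i : 0 <= (t ^+ i - c ^+ i) * (t - c).
  have [tc|/ltW ct] := leP t c.
    by apply: mulr_le0; rewrite subr_le0// lerXn2r.
  by apply: mulr_ge0; rewrite subr_ge0// lerXn2r.
have step i : i.+1%:R * t ^+ i.+2 - i.+2%:R * c * t ^+ i.+1 + c ^+ i.+2 =
    t * (i%:R * t ^+ i.+1 - i.+1%:R * c * t ^+ i + c ^+ i.+1) +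
    (t ^+ i.+1 - c ^+ i.+1) * (t - c).
  by rewrite -!natr1 !exprS; ring.
have pos i : 0 <= i%:R * t ^+ i.+1 - i.+1%:R * c * t ^+ i + c ^+ i.+1.
  elim: i => [|i ih]; first by rewrite mul0r expr0 expr1; lra.
  by rewrite step addr_ge0// mulr_ge0.
by case: j => // j _; rewrite step lerDr mulr_ge0.
Qed.

Lemma amgm_gap_eq0 (R : realDomainType) (t c : R) j : (1 <= j)%N -> 0 <= t -> 0 <= c ->
  j%:R * t ^+ j.+1 - j.+1%:R * c * t ^+ j + c ^+ j.+1 = 0 -> t = c.
Proof.
move=> j1 t0 c0 gap0; have := amgm_gap j1 t0 c0; rewrite gap0 => le0.
have [tc|ct|//] := ltgtP t c.
  have : 0 < (t ^+ j - c ^+ j) * (t - c).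
    by rewrite nmulr_lgt0 subr_lt0// ltrXn2r// -lt0n.
  by rewrite ltNge le0.
have : 0 < (t ^+ j - c ^+ j) * (t - c).
  by rewrite pmulr_lgt0 subr_gt0// ltrXn2r// -lt0n.
by rewrite ltNge le0.
Qed.

Section moment_roots.
Context d (T : measurableType d) (R : realType) (mu : probability T R).
Variables (Z : T -> R) (p : nat).
Hypothesis Z0 : forall v, 0 <= Z v.
Hypothesis (iZ : forall j, (j <= p)%N -> mu.-integrable setT (EFin \o (fun v => Z v ^+ j))).

Let a j := (\int[mu]_v (Z v ^+ j))%R.

Hypothesis Z_non_cst : ~ (exists2 b, 0 <= b & {ae mu, forall v, Z v = b}).

Lemma moment_gt0 j : (1 <= j)%N -> (j <= p)%N -> 0 < a j.
Proof.
move=> j1 jp.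
have aj_ge0 : 0 <= a j by apply: Rintegral_ge0 => v _; rewrite exprn_ge0.
rewrite lt_neqAle aj_ge0 andbT; apply/eqP => /esym aj.
apply: Z_non_cst; exists 0 => //.
have := Rintegral_eq0_ae (iZ jp) (fun v => exprn_ge0 _ (Z0 v)) aj.
by apply: filterS => v /eqP; rewrite expf_eq0 => /andP[_ /eqP].
Qed.

(** With c = (E Z^j)^(1/j), the expectation of the gap in [amgm_gap] at t = Z is
    j (E Z^(j+1) - c^(j+1)); it is positive because the gap vanishes only for
    Z = c. *)
Lemma moment_root_mono j : (1 <= j)%N -> (j < p)%N ->
  a j `^ j%:R^-1 < a j.+1 `^ j.+1%:R^-1.
Proof.
move=> j1 jp.
have j0 : j%:R != 0 :> R by rewrite pnatr_eq0 -lt0n.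
have aj0 : 0 < a j by apply: moment_gt0 => //; exact: ltnW.
set c := a j `^ j%:R^-1.
have c0 : 0 < c by rewrite powR_gt0.
have cj : c ^+ j = a j by rewrite -powR_mulrn ?ltW// -powRrM mulVf// powRr1 ?ltW.
pose q v := j%:R * Z v ^+ j.+1 - j.+1%:R * c * Z v ^+ j + c ^+ j.+1.
have q0 v : 0 <= q v.
  apply: le_trans (amgm_gap j1 (Z0 v) (ltW c0)).
  have [tc|/ltW ct] := leP (Z v) c.
    by apply: mulr_le0; rewrite subr_le0// lerXn2r// nnegrE// ltW.
  by apply: mulr_ge0; rewrite subr_ge0// lerXn2r// nnegrE// ltW.
have ij := iZ (ltnW jp); have ij1 := iZ jp.
have iZl (b : R) i : mu.-integrable setT (EFin \o (fun v => Z v ^+ i)) ->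
    mu.-integrable setT (EFin \o (fun v => b * Z v ^+ i)).
  by move=> ii; exact: (integrableZl measurableT b ii).
have icst (b : R) : mu.-integrable setT (EFin \o (fun _ : T => b)).
  exact: finite_measure_integrable_cst.
have iB : mu.-integrable setT
    (EFin \o (fun v => j%:R * Z v ^+ j.+1 - j.+1%:R * c * Z v ^+ j)).
  exact: (integrableB measurableT (iZl _ _ ij1) (iZl _ _ ij)).
have iq : mu.-integrable setT (EFin \o q).
  exact: (integrableD measurableT iB (icst (c ^+ j.+1))).
have qE : \int[mu]_v q v = j%:R * (a j.+1 - c ^+ j.+1).
  rewrite RintegralD// RintegralB//; [|exact: iZl..].
  rewrite !RintegralZl// Rintegral_cst// [X in fine X](@probability_setT _ _ _ mu).
  by rewrite -/(a j) -/(a j.+1) -cj /= -natr1 exprS; ring.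
have : 0 < \int[mu]_v q v.
  rewrite lt_neqAle Rintegral_ge0 ?andbT//; apply/eqP => /esym q00.
  apply: Z_non_cst; exists c; first exact: ltW.
  have := Rintegral_eq0_ae iq q0 q00.
  by apply: filterS => v; apply: amgm_gap_eq0 => //; exact: ltW.
rewrite qE pmulr_rgt0 ?ltr0n// subr_gt0 => cj1.
have -> : c = (c ^+ j.+1) `^ j.+1%:R^-1.
  by rewrite -powR_mulrn ?ltW// -powRrM mulfV ?pnatr_eq0// powRr1 ?ltW.
by apply: gt0_ltr_powR; rewrite ?invr_gt0 ?ltr0n ?nnegrE ?exprn_ge0// ?(ltW c0)//; apply: Rintegral_ge0 => v _; rewrite exprn_ge0.
Qed.

End moment_roots.

Lemma moment_vector_cone_or_diag d (T : measurableType d) (R : realType)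
    (mu : probability T R) (Z : T -> R) (p : nat) (x : 'rV[R]_p) :
  (forall v, 0 <= Z v) ->
  (forall j, (j <= p)%N -> mu.-integrable setT (EFin \o (fun v => Z v ^+ j))) ->
  (forall j, x ord0 j = \int[mu]_v (Z v ^+ j.+1)) ->
  (@moment_cone R p `|` @moment_diag R p) x.
Proof.
move=> Z0 iZ xa.
have [[b b0 Zb]|ncst] := pselect (exists2 b, 0 <= b & {ae mu, forall v, Z v = b}).
  right.
  have xb (j : 'I_p) : x ord0 j = b ^+ j.+1.
    transitivity (\int[mu]_v (b ^+ j.+1))%R.
      rewrite xa; congr fine; apply: ae_eq_integral => //.
        exact: measurable_int (iZ _ (ltn_ord j)).
      have Zbj : {ae mu, forall v, setT v -> (Z v ^+ j.+1)%:E = (b ^+ j.+1)%:E}.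
        by apply: filterS Zb => v -> _.
      exact: Zbj.
    by rewrite Rintegral_cst// [X in fine X](@probability_setT _ _ _ mu) mulr1.
  have rootb (j : 'I_p) : moment_root x j = b.
    by rewrite /moment_root xb -powR_mulrn// -powRrM mulfV ?pnatr_eq0// powRr1.
  split=> [j|i j]; first by rewrite xb exprn_ge0.
  by rewrite !rootb.
left; split=> [j|i j ij]; first by rewrite xa; exact: (moment_gt0 Z0 iZ).
rewrite /moment_root !xa.
move: ij (ltn_ord j); elim: (nat_of_ord j) => // l ih il lp.
have lt_l := moment_root_mono Z0 iZ ncst (isT : (0 < l.+1)%N) lp.
move: il; rewrite ltnS leq_eqVlt => /predU1P[->//|il].
by apply: lt_trans lt_l; apply: ih => //; exact: ltnW.
Qed.

(** * Moments under dominated couplings *)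

Lemma integral_min_excess d (T : measurableType d) (R : realType)
    (mu : {measure set T -> \bar R}) (f : T -> R) (N : R) :
  measurable_fun setT f -> (forall x, 0 <= f x) -> 0 <= N ->
  (\int[mu]_x (f x)%:E =
   \int[mu]_x (Num.min (f x) N)%:E + \int[mu]_x (Num.max 0 (f x - N))%:E)%E.
Proof.
move=> mf f0 N0; rewrite -ge0_integralD//.
- apply: eq_integral => x _; rewrite -EFinD; congr (_%:E).
  have [fN|Nf] := leP (f x) N.
    by rewrite (max_idPl _) ?subr_le0// addr0.
  by rewrite (max_idPr _) ?subr_ge0 ?(ltW Nf)//; ring.
- by move=> x _; rewrite lee_fin le_min f0.
- by apply/measurable_EFinP; apply: measurable_minr.
- by move=> x _; rewrite lee_fin le_max lexx.
- by apply/measurable_EFinP; apply: measurable_maxr => //; apply: measurable_funB.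
Qed.

Section coupling_moments.
Context (R : realType) (n : nat) (d : measure_display) (Omega : measurableType d)
  (P : probability Omega R) (X : {RV P >-> borel_rV R n}).
Hypothesis X_ge0 : forall w i, 0 <= (X w : 'rV[R]_n) ord0 i.

Let Xi i w := (X w : 'rV[R]_n) ord0 i.

Lemma measurable_coord i : measurable_fun setT (fun x : borel_rV R n => (x : 'rV[R]_n) ord0 i).
Proof.
apply: (@continuous_measurable_R _ _ (fun x : 'rV[R]_n => x ord0 i)).
exact: coord_continuous.
Qed.

Lemma measurable_Xi i : measurable_fun setT (Xi i).
Proof.
by apply: (measurableT_comp (measurable_coord i)); exact: measurable_funP.
Qed.

Lemma Xpow_ge0 i j w : 0 <= Xi i w ^+ j.
Proof. by rewrite exprn_ge0// X_ge0. Qed.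

Section one_coordinate.
Variables (i : 'I_n) (p : nat).
Hypothesis Xp_lty : (\int[P]_w (Xi i w ^+ p)%:E < +oo)%E.

Lemma Xpow_lty j : (j <= p)%N -> (\int[P]_w (Xi i w ^+ j)%:E < +oo)%E.
Proof.
move=> jp.
have mX l : measurable_fun setT (fun w => (Xi i w ^+ l)%:E).
  by apply/measurable_EFinP; apply: measurable_funX; exact: measurable_Xi.
apply: (@le_lt_trans _ _ (\int[P]_w (1 + (Xi i w ^+ p)%:E))%E).
  apply: ge0_le_integral => //.
  - by move=> w _; rewrite lee_fin Xpow_ge0.
  - by apply: emeasurable_funD.
  - move=> w _; rewrite lee_fin; have X0 := X_ge0 w i.
    have [X1|/ltW X1] := leP (Xi i w) 1.
      by apply: ler_wpDr; rewrite ?Xpow_ge0// exprn_ile1.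
    by apply: ler_wpDl => //; apply: ler_weXn2l.
rewrite ge0_integralD//; last by move=> w _; rewrite lee_fin Xpow_ge0.
by rewrite integral_cst// mul1e [X in (X + _)%E](@probability_setT _ _ _ P) lte_add_pinfty// ltry.
Qed.

(** This number does not depend on a coupling: it bounds the truncation error
    of the moments of z_i uniformly over all of them. *)
Definition tail j N : \bar R := (\int[P]_w (Num.max 0 (Xi i w ^+ j - N))%:E)%E.

Lemma tail_cvg j : (j <= p)%N -> fine (tail j N%:R) @[N --> \oo] --> (0 : R).
Proof.
move=> jp; have X0 w : 0 <= Xi i w ^+ j by exact: Xpow_ge0.
have mX : measurable_fun setT (fun w => Xi i w ^+ j).
  by apply: measurable_funX; exact: measurable_Xi.
have Sfin : (\int[P]_w (Xi i w ^+ j)%:E)%E \is a fin_num.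
  by rewrite ge0_fin_numE ?Xpow_lty// integral_ge0// => w _; rewrite lee_fin.
have split N := integral_min_excess P mX X0 (ler0n R N).
have cv := integral_min_nat_cvg (mu := P) mX X0.
rewrite -(fineK Sfin) in cv; have {}cv := fine_cvg cv.
have -> : (fun N => fine (tail j N%:R)) = (fun N =>
    fine (\int[P]_w (Xi i w ^+ j)%:E) - fine (\int[P]_w (Num.min (Xi i w ^+ j) N%:R)%:E)).
  apply/funext => N; have := Sfin; rewrite (split N) fin_numD => /andP[af bf].
  by rewrite [X in _ = X - _](fineD af bf) addrC addKr.
rewrite -(subrr (fine (\int[P]_w (Xi i w ^+ j)%:E))).
by apply: cvgB; [exact: cvg_cst|exact: cv].
Qed.

Lemma tail_fin_num j N : (j <= p)%N -> 0 <= N -> tail j N \is a fin_num.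
Proof.
move=> jp N0; have X0 w : 0 <= Xi i w ^+ j by exact: Xpow_ge0.
have mX : measurable_fun setT (fun w => Xi i w ^+ j).
  by apply: measurable_funX; exact: measurable_Xi.
have : (\int[P]_w (Xi i w ^+ j)%:E)%E \is a fin_num.
  by rewrite ge0_fin_numE ?Xpow_lty// integral_ge0// => w _; rewrite lee_fin.
by rewrite (integral_min_excess P mX X0 N0) fin_numD => /andP[].
Qed.

(** The positive part makes the functions nonnegative everywhere; under a
    dominated coupling it changes them on a null set only. *)
Definition zpow j (v : 'rV[R]_(n + n)) : R := Num.max 0 (zcoord i v) ^+ j.
Definition xpow j (v : 'rV[R]_(n + n)) : R := Num.max 0 (xcoord i v) ^+ j.

Lemma zpow_ge0 j v : 0 <= zpow j v.
Proof. by rewrite exprn_ge0// le_max lexx. Qed.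

Lemma xpow_ge0 j v : 0 <= xpow j v.
Proof. by rewrite exprn_ge0// le_max lexx. Qed.

Lemma zpow_continuous j : continuous (zpow j).
Proof.
apply: continuous_expr; apply: continuous_maxr; first exact: cst_continuous.
exact: zcoord_continuous.
Qed.

Lemma xpow_continuous j : continuous (xpow j).
Proof.
apply: continuous_expr; apply: continuous_maxr; first exact: cst_continuous.
exact: xcoord_continuous.
Qed.

Lemma measurable_zpow j : measurable_fun [set: borel_rV R (n + n)] (zpow j).
Proof. by apply: continuous_measurable_R; exact: zpow_continuous. Qed.

Lemma measurable_xpow j : measurable_fun [set: borel_rV R (n + n)] (xpow j).
Proof. by apply: continuous_measurable_R; exact: xpow_continuous. Qed.

Section one_coupling.
Variable nu : probability (borel_rV R (n + n)) R.
Hypothesis nuX : dominated_coupling X nu.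

Lemma coupling_xpow j : (\int[nu]_v (xpow j v)%:E = \int[P]_w (Xi i w ^+ j)%:E)%E.
Proof.
pose h (x : 'rV[R]_n) := Num.max 0 (x ord0 i) ^+ j.
have ch : continuous h.
  apply: continuous_expr; apply: continuous_maxr; first exact: cst_continuous.
  exact: coord_continuous.
have h0 x : 0 <= h x by rewrite exprn_ge0// le_max lexx.
rewrite [LHS](nuX.1 h ch h0); apply: eq_integral => w _; rewrite /h.
by rewrite (max_idPr _)// X_ge0.
Qed.

Lemma coupling_xtail j N :
  (\int[nu]_v (Num.max 0 (xpow j v - N))%:E = tail j N)%E.
Proof.
pose h (x : 'rV[R]_n) := Num.max 0 (Num.max 0 (x ord0 i) ^+ j - N).
have ch : continuous h.
  apply: continuous_maxr; first exact: cst_continuous.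
  apply: continuous_subr; last exact: cst_continuous.
  apply: continuous_expr; apply: continuous_maxr; first exact: cst_continuous.
  exact: coord_continuous.
have h0 x : 0 <= h x by rewrite le_max lexx.
rewrite [LHS](nuX.1 h ch h0); apply: eq_integral => w _; rewrite /h.
by rewrite [Num.max 0 (_ ord0 i)](max_idPr _)// X_ge0.
Qed.

Lemma zpow_le_xpow j : {ae nu, forall v : borel_rV R (n + n), zpow j v <= xpow j v}.
Proof.
apply: filterS nuX.2 => v /(_ i)/andP[z0 zx].
rewrite /zpow /xpow (max_idPr z0) (max_idPr (le_trans z0 zx)).
by rewrite lerXn2r// nnegrE// (le_trans z0 zx).
Qed.

Lemma zpow_integrable j : (j <= p)%N -> nu.-integrable setT (EFin \o zpow j).
Proof.
move=> jp; apply/integrableP; split.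
  by apply/measurable_EFinP; exact: measurable_zpow.
under eq_integral do rewrite /= ger0_norm ?zpow_ge0//.
apply: le_lt_trans (Xpow_lty jp); rewrite -coupling_xpow.
apply: ae_ge0_le_integral => //.
- by move=> v _; rewrite lee_fin zpow_ge0.
- by apply/measurable_EFinP; exact: measurable_zpow.
- by move=> v _; rewrite lee_fin xpow_ge0.
- by apply/measurable_EFinP; exact: measurable_xpow.
- by apply: filterS (zpow_le_xpow j) => v zx _; rewrite lee_fin.
Qed.

Lemma coupling_momentE j : fine 'E_nu[fun v => zcoord i v ^+ j] = \int[nu]_v zpow j v.
Proof.
rewrite unlock /Rintegral; congr fine; apply: ae_eq_integral => //.
- apply/measurable_EFinP; apply: measurable_funX; exact: measurable_zcoord.
- by apply/measurable_EFinP; exact: measurable_zpow.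
have H : {ae nu, forall v, setT v -> (zcoord i v ^+ j)%:E = (zpow j v)%:E}.
  apply: filterS nuX.2 => v /(_ i)/andP[z0 _] _.
  by rewrite /zpow (max_idPr z0).
exact: H.
Qed.

(** The function t |-> (t^j - N)^+ is nondecreasing, so 0 <= z_i <= x_i bounds the
    truncation error for z_i by that for x_i. *)
Lemma moment_truncation j N : (j <= p)%N -> 0 <= N ->
  `|\int[nu]_v zpow j v - bint nu (fun v => Num.min (zpow j v) N)| <= fine (tail j N).
Proof.
move=> jp N0.
have bmin : bcont (fun v => Num.min (zpow j v) N).
  apply: (@bcont_btw _ _ _ 0 N).
    by apply: continuous_minr; [exact: zpow_continuous|exact: cst_continuous].
  by move=> v; rewrite le_min zpow_ge0 N0 ge_min lexx orbT.
have zfin := integrable_fin_num measurableT (zpow_integrable jp).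
have zE := integral_min_excess nu (measurable_zpow j) (zpow_ge0 j) N0.
have := zfin; rewrite [X in X \is a fin_num]zE fin_numD => /andP[afin bfin].
have -> : \int[nu]_v zpow j v - bint nu (fun v => Num.min (zpow j v) N) =
    fine (\int[nu]_v (Num.max 0 (zpow j v - N))%:E).
  by rewrite /Rintegral zE fineD// /bint /Rintegral addrAC subrr add0r.
rewrite ger0_norm ?fine_ge0 ?integral_ge0//; last first.
  by move=> v _; rewrite lee_fin le_max lexx.
rewrite fine_le ?tail_fin_num// -coupling_xtail.
apply: ae_ge0_le_integral => //.
- by move=> v _; rewrite lee_fin le_max lexx.
- apply/measurable_EFinP; apply: measurable_maxr => //; apply: measurable_funB => //.
  exact: measurable_zpow.
- by move=> v _; rewrite lee_fin le_max lexx.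
- apply/measurable_EFinP; apply: measurable_maxr => //; apply: measurable_funB => //.
  exact: measurable_xpow.
apply: filterS (zpow_le_xpow j) => v zx _; rewrite lee_fin.
by rewrite ge_max le_max lexx/= le_max lerD2r zx orbT.
Qed.

Lemma moments_cone_or_diag :
  (@moment_cone R p `|` @moment_diag R p) (moments p i nu).
Proof.
apply: (@moment_vector_cone_or_diag _ (borel_rV R (n + n)) R nu (zpow 1)).
- by move=> v; exact: zpow_ge0.
- move=> j jp; have := zpow_integrable jp; rewrite /zpow.
  by under [X in EFin \o X]eq_fun do rewrite -[Num.max _ _]expr1.
- by move=> j; rewrite mxE coupling_momentE.
Qed.

End one_coupling.

(** A uniform limit of continuous functions: approximate each moment by a
    truncated one up to e / 3. *)
Lemma moments_cvg (A : set (borel_proba R (n + n))) (nu : borel_proba R (n + n)) :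
  (forall mu, A mu -> dominated_coupling X mu) -> A nu ->
  (fun mu : borel_proba R (n + n) => moments p i mu) @ within A (nbhs nu)
     --> moments p i nu.
Proof.
move=> AX Anu; apply: cvg_rV => j; apply/cvgrPdist_le => e e0.
have jp : (j.+1 <= p)%N by exact: ltn_ord.
have e30 : 0 < e / 3 by rewrite divr_gt0.
have /cvgrPdist_le /(_ _ e30) [N _ /(_ N (leqnn N))] := tail_cvg jp.
rewrite sub0r normrN /= => tailN.
pose g (v : 'rV[R]_(n + n)) := Num.min (zpow j.+1 v) N%:R.
have bg : bcont g.
  apply: (@bcont_btw _ _ _ 0 N%:R).
    by apply: continuous_minr; [exact: zpow_continuous|exact: cst_continuous].
  by move=> v; rewrite le_min zpow_ge0 ler0n ge_min lexx orbT.
have trunc mu : A mu -> `|moments p i mu ord0 j - bint mu g| <= e / 3.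
  move=> Amu; rewrite mxE (coupling_momentE (AX _ Amu)).
  apply: le_trans (moment_truncation (AX _ Amu) jp (ler0n R N)) _.
  exact: le_trans (ler_norm _) tailN.
have /cvgrPdist_le /(_ _ e30) near_g := @bint_continuous _ _ _ bg nu.
apply: filterS near_g => mu gmu Amu.
have := trunc _ Anu; have := trunc _ Amu; move: gmu.
rewrite !ler_norml => /andP[? ?] /andP[? ?] /andP[? ?]; apply/andP; split; lra.
Qed.

End one_coordinate.

End coupling_moments.

(** * The utility function *)

(** Holds as well when the integral of g is infinite; both sides are then -oo. *)
Lemma integral_cstB d (T : measurableType d) (R : realType)
    (mu : probability T R) (a : R) (g : T -> R) :
  measurable_fun setT g -> (forall x, 0 <= g x) ->
  (\int[mu]_x (a - g x)%:E = a%:E - \int[mu]_x (g x)%:E)%E.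
Proof.
move=> mg g0.
have mg' : measurable_fun setT (EFin \o g) by exact/measurable_EFinP.
have mf : measurable_fun setT (fun x => (a - g x)%:E).
  by apply/measurable_EFinP; apply: measurable_funB.
have muT : mu setT = 1%E by exact: probability_setT.
have int_ge0 : (0 <= \int[mu]_x (g x)%:E)%E.
  by apply: integral_ge0 => x _; rewrite lee_fin.
have [gfin|] := ltP (\int[mu]_x (g x)%:E)%E +oo%E.
  have ig : mu.-integrable setT (EFin \o g).
    apply/integrableP; split=> //.
    by under eq_integral do rewrite /= ger0_norm//.
  have ia : mu.-integrable setT (EFin \o (fun _ : T => a)).
    exact: finite_measure_integrable_cst.
  rewrite (integralB_EFin measurableT ia ig) integral_cst//.
  by rewrite [X in (_ * X)%E]muT mule1.
rewrite leye_eq => /eqP goo; rewrite goo.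
rewrite integralE.
have pfin : (\int[mu]_x (fun x => (a - g x)%:E)^\+ x <= `|a|%:E)%E.
  apply: (@le_trans _ _ (\int[mu]_x `|a|%:E)%E).
    apply: ge0_le_integral => //.
    - exact: measurable_funepos.
    - move=> x _; rewrite funeposE -EFin_max lee_fin ge_max normr_ge0 andbT.
      by rewrite lerBlDr (le_trans (ler_norm a))// lerDl.
  by rewrite integral_cst// [X in (_ * X)%E]muT mule1.
have ninf : (\int[mu]_x (fun x => (a - g x)%:E)^\- x = +oo)%E.
  apply/eqP; rewrite -leye_eq.
  have : (\int[mu]_x (g x)%:E <= \int[mu]_x ((fun x => (a - g x)%:E)^\- x + `|a|%:E))%E.
    apply: ge0_le_integral => //.
    - by move=> x _; rewrite lee_fin.
    - by apply: emeasurable_funD => //; exact: measurable_funeneg.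
    - move=> x _; rewrite funenegE -EFinN -EFin_max -EFinD lee_fin -lerBlDr.
      rewrite le_max; apply/orP; left; have := ler_norm a; lra.
  rewrite goo ge0_integralD//; last exact: measurable_funeneg.
  rewrite integral_cst// [X in (_ * X)%E]muT mule1.
  case: (\int[mu]_x _)%E => //.
have : (0 <= \int[mu]_x (fun x => (a - g x)%:E)^\+ x)%E by exact: integral_ge0.
rewrite ninf; move: pfin; case: (\int[mu]_x _)%E => //.
Qed.

Section utility.
Context (R : realType) (c : R) (U : R -> R).
Hypothesis Uconc : concave_function (`]-oo, c]%classic) U.
Hypothesis Umono : {in `]-oo, c] &, {homo U : x y / x <= y}}.

(** U is meaningful on ]-oo, c] only. A concave function may jump downwards at
    the endpoint c; since U is nondecreasing, this is excluded, and the extension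
    by a constant is concave on the whole line. *)
Definition Uext y := U (Num.min y c).

Lemma Uext_homo : {homo Uext : x y / x <= y}.
Proof.
move=> x y xy; apply: Umono.
- by rewrite in_itv/= ge_min lexx orbT.
- by rewrite in_itv/= ge_min lexx orbT.
- by rewrite le_min !ge_min xy lexx orbT.
Qed.

Lemma U_concave t x y : 0 <= t <= 1 -> x <= c -> y <= c ->
  t * U x + (1 - t) * U y <= U (t * x + (1 - t) * y).
Proof.
move=> /andP[t0 t1] xc yc.
pose t' : {i01 R} := Itv01 t0 t1.
have := @Uconc t' x y.
rewrite !inE/= !in_itv/= => /(_ xc yc).
rewrite !convRE/= /unstable.onem !mulrN => le.
have {}le : - U (t * x + (1 - t) * y) <= - (t * U x) - (1 - t) * U y := le.
lra.
Qed.

Lemma Uext_concave t x y : 0 <= t <= 1 ->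
  t * Uext x + (1 - t) * Uext y <= Uext (t * x + (1 - t) * y).
Proof.
move=> t01; have /andP[t0 t1] := t01.
have mc z : Num.min z c <= c by rewrite ge_min lexx orbT.
have mz z : Num.min z c <= z by rewrite ge_min lexx.
apply: le_trans (U_concave t01 (mc x) (mc y)) _.
have tt0 : 0 <= 1 - t by rewrite subr_ge0.
have le_c : t * Num.min x c + (1 - t) * Num.min y c <= c.
  have := ler_wpM2l t0 (mc x); have := ler_wpM2l tt0 (mc y); lra.
apply: Umono; rewrite ?in_itv//= ?mc// le_min le_c andbT.
by apply: lerD; apply: ler_wpM2l.
Qed.

(** With K = Uext x - Uext (x - 1), concavity bounds the increment of Uext
    from x to x + h by K h and from x - h to x by K h, for h in [0, 1]. *)
Lemma Uext_continuous : continuous Uext.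
Proof.
move=> x; pose K := Uext x - Uext (x - 1).
have K0 : 0 <= K by rewrite subr_ge0 Uext_homo// gerBl.
have right h : 0 <= h -> 0 <= Uext (x + h) - Uext x <= h * K.
  move=> h0; rewrite subr_ge0 Uext_homo ?lerDl//=.
  have h1 : 0 < 1 + h by rewrite ltr_wpDr.
  have t01 : 0 <= (1 + h)^-1 <= 1 by rewrite invr_ge0 ltW//= invf_le1// lerDl.
  have := Uext_concave (x + h) (x - 1) t01.
  have -> : (1 + h)^-1 * (x + h) + (1 - (1 + h)^-1) * (x - 1) = x.
    by field; rewrite gt_eqF.
  rewrite -(ler_pM2l h1).
  have -> : (1 + h) * ((1 + h)^-1 * Uext (x + h) + (1 - (1 + h)^-1) * Uext (x - 1)) =
      Uext (x + h) + h * Uext (x - 1) by field; rewrite gt_eqF.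
  rewrite /K; lra.
have left h : 0 <= h <= 1 -> 0 <= Uext x - Uext (x - h) <= h * K.
  move=> /andP[h0 h1]; rewrite subr_ge0 Uext_homo ?gerBl//=.
  have t01 : 0 <= 1 - h <= 1 by rewrite subr_ge0 h1 gerBl.
  have := Uext_concave x (x - 1) t01.
  have -> : (1 - h) * x + (1 - (1 - h)) * (x - 1) = x - h by ring.
  rewrite /K; lra.
apply/cvgrPdist_le => e e0; near=> y.
have yx1 : `|x - y| <= 1 by near: y; apply: cvgr_dist_le => //; exact: cvg_id.
have yxe : `|x - y| <= e / (K + 1).
  by near: y; apply: cvgr_dist_le; [exact: cvg_id|rewrite divr_gt0// ltr_wpDl].
have K1 : 0 < K + 1 by rewrite ltr_wpDl.
have {}yxe : `|x - y| * K <= e.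
  move: yxe; rewrite ler_pdivlMr//; apply: le_trans.
  by rewrite ler_wpM2l// lerDl.
have [xy|/ltW yx] := leP x y.
  have hxy : 0 <= y - x by rewrite subr_ge0.
  have := right _ hxy; rewrite subrKC => /andP[le0 leK].
  rewrite distrC ger0_norm//; apply: (le_trans leK).
  by rewrite distrC ger0_norm in yxe.
have hxy : 0 <= x - y by rewrite subr_ge0.
have hxy1 : 0 <= x - y <= 1 by rewrite hxy/= -(ger0_norm hxy).
have := left _ hxy1; rewrite subKr => /andP[le0 leK].
rewrite ger0_norm//; apply: (le_trans leK).
by rewrite ger0_norm in yxe.
Unshelve. all: by end_near. Qed.

Definition disutility y := U c - Uext y.

Lemma disutility_ge0 y : 0 <= disutility y.
Proof.
by rewrite subr_ge0; apply: Umono; rewrite ?in_itv/= ?ge_min lexx ?orbT.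
Qed.

Lemma disutility_nonincreasing x y : x <= y -> disutility y <= disutility x.
Proof. by move=> xy; rewrite lerD2l lerN2 Uext_homo. Qed.

Lemma disutility_continuous : continuous disutility.
Proof.
by apply: continuous_subr; [exact: cst_continuous|exact: Uext_continuous].
Qed.

End utility.

(** * Tightness of dominated couplings *)

Section tightness.
Context (R : realType) (n : nat) (d : measure_display) (Omega : measurableType d)
  (P : probability Omega R) (X : {RV P >-> borel_rV R n}).
Hypothesis X_ge0 : forall w i, 0 <= (X w : 'rV[R]_n) ord0 i.
Hypothesis X_lty : forall i, (\int[P]_w ((X w : 'rV[R]_n) ord0 i)%:E < +oo)%E.

Lemma norm_le_sum_x (v : 'rV[R]_(n + n)) :
  (forall i, 0 <= zcoord i v <= xcoord i v) ->
  `|v| <= \sum_(i < n) Num.max 0 (xcoord i v).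
Proof.
move=> zx; have sum_ge i : xcoord i v <= \sum_(i < n) Num.max 0 (xcoord i v).
  rewrite (bigD1 i)//= ler_wpDr ?le_max ?lexx ?orbT//.
  by apply: sumr_ge0 => j _; rewrite le_max lexx.
rewrite [`|v|]/Num.norm/= mx_normrE; apply/bigmax_leP; split.
  by apply: sumr_ge0 => i _; rewrite le_max lexx.
move=> [a j] _ /=; rewrite (ord1 a).
rewrite -[j]splitK; case: (fintype.split j) => i /=; have /andP[z0 zxi] := zx i.
  have <- : xcoord i v = v ord0 (lshift n i) by rewrite /xcoord /xpart mxE.
  by rewrite ger0_norm ?(le_trans z0)// sum_ge.
have <- : zcoord i v = v ord0 (rshift n i) by rewrite /zcoord /zpart mxE.
by rewrite ger0_norm// (le_trans zxi)// sum_ge.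
Qed.

(** Markov's inequality: the integral of |v| is at most C = E (sum_i X_i). *)
Lemma dominated_uniformly_tight (A : set (borel_proba R (n + n))) :
  (forall nu, A nu -> dominated_coupling X nu) -> uniformly_tight A.
Proof.
move=> AX e e0.
pose S w := \sum_(i < n) (X w : 'rV[R]_n) ord0 i.
have S0 w : 0 <= S w by apply: sumr_ge0 => i _; exact: X_ge0.
have mXi i : measurable_fun setT (fun w => (X w : 'rV[R]_n) ord0 i).
  exact: measurable_Xi.
have SE : (\int[P]_w (S w)%:E = \sum_(i < n) \int[P]_w ((X w : 'rV[R]_n) ord0 i)%:E)%E.
  rewrite -ge0_integral_sum//.
  - by apply: eq_integral => w _; rewrite sumEFin.
  - by move=> i; apply/measurable_EFinP.
  - by move=> i w _; rewrite lee_fin.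
have Sfin : (\int[P]_w (S w)%:E)%E \is a fin_num.
  rewrite SE; apply/sum_fin_numP => i _ _.
  by rewrite ge0_fin_numE ?X_lty// integral_ge0// => w _; rewrite lee_fin.
set C := fine (\int[P]_w (S w)%:E).
have C0 : 0 <= C by rewrite fine_ge0// integral_ge0// => w _; rewrite lee_fin.
pose M := (C + 1) / e.
have M0 : 0 < M by rewrite divr_gt0// ltr_wpDl.
exists M => // nu /AX nuX.
pose h (x : 'rV[R]_n) := M^-1 * \sum_(i < n) Num.max 0 (x ord0 i).
have ch : continuous h.
  apply: continuous_mulr; first exact: cst_continuous.
  apply: continuous_sumr => i; apply: continuous_maxr; first exact: cst_continuous.
  exact: coord_continuous.
have h0 x : 0 <= h x.
  rewrite mulr_ge0 ?invr_ge0 ?(ltW M0)//.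
  by apply: sumr_ge0 => i _; rewrite le_max lexx.
rewrite -lee_fin -bintE; last exact: bcont_min_norm.
apply: (@le_trans _ _ (\int[nu]_v (h (xpart v))%:E)%E).
  apply: ae_ge0_le_integral => //.
  - by move=> v _; rewrite lee_fin le_min ler01 divr_ge0// ltW.
  - apply/measurable_EFinP; apply: continuous_measurable_R.
    by case: (bcont_min_norm (n + n) M0).
  - by move=> v _; rewrite lee_fin.
  - apply/measurable_EFinP; apply: measurableT_comp; last exact: measurable_xpart.
    exact: continuous_measurable_R.
  - apply: filterS nuX.2 => v zx _; rewrite lee_fin.
    by rewrite ge_min mulrC ler_pM2l ?invr_gt0// (norm_le_sum_x zx) orbT.
rewrite [leLHS](nuX.1 h ch h0).
have -> : (\int[P]_w (h (X w))%:E = \int[P]_w ((M^-1)%:E * (S w)%:E))%E.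
  apply: eq_integral => w _; rewrite -EFinM /h; congr (_ * _)%:E.
  by apply: eq_bigr => i _; rewrite (max_idPr _).
rewrite ge0_integralZl//; first last.
- by rewrite lee_fin invr_ge0 ltW.
- by move=> w _; rewrite lee_fin.
- by apply/measurable_EFinP; apply: measurable_sum.
rewrite -(fineK Sfin) -EFinM lee_fin -/C /M invf_div.
by rewrite mulrAC ler_pdivrMr ?ltr_wpDl// ler_pM2l// lerDl.
Qed.

End tightness.

(** * Upper semicontinuity of expected utility *)

Lemma gt_nbhs (R : realType) (a x : R) : a < x -> nbhs x [set y | a < y].
Proof. by move=> ax; apply: open_nbhs_nbhs; split=> //; exact: open_gt. Qed.

Lemma cvg_sumr (R : realType) (T I : Type) (F : set_system T) (FF : Filter F)
    (s : seq I) (f : I -> T -> R) (l : I -> R) :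
  (forall i, f i @ F --> l i) ->
  (fun t => \sum_(i <- s) f i t) @ F --> \sum_(i <- s) l i.
Proof.
move=> fl; elim: s => [|i s ih].
  by rewrite big_nil; under eq_fun do rewrite big_nil; exact: cvg_cst.
by rewrite big_cons; under eq_fun do rewrite big_cons; exact: cvgD.
Qed.

Section expected_utility.
Context (R : realType) (n : nat) (d : measure_display) (Omega : measurableType d)
  (P : probability Omega R) (X : {RV P >-> borel_rV R n}).
Hypothesis X_ge0 : forall w i, 0 <= (X w : 'rV[R]_n) ord0 i.
Context (k : 'I_n -> nat) (Psi : forall i : 'I_n, 'rV[R]_(k i) -> R).
Hypothesis X_lty : forall i, (\int[P]_w ((X w : 'rV[R]_n) ord0 i ^+ k i)%:E < +oo)%E.
Hypothesis Psi_ge0 : forall (i : 'I_n) (x : 'rV[R]_(k i)),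
  (forall j, 0 <= x ord0 j) -> 0 <= Psi x.
Hypothesis Psi_cont : forall i : 'I_n,
  {within (@moment_cone R (k i)) `|` (@moment_diag R (k i)), continuous (@Psi i)}.
Context (c : R) (U : R -> R).
Hypothesis Uconc : concave_function (`]-oo, c]%classic) U.
Hypothesis Umono : {in `]-oo, c] &, {homo U : x y / x <= y}}.

Definition total_premium (nu : probability (borel_rV R (n + n)) R) : R :=
  \sum_(i < n) premium Psi i nu.

(** The part of the total risk that is not ceded. *)
Definition retained (v : 'rV[R]_(n + n)) : R := \sum_(i < n) (xcoord i v - zcoord i v).

Lemma retained_continuous : continuous retained.
Proof.
apply: continuous_sumr => i; apply: continuous_subr.
  exact: xcoord_continuous.
exact: zcoord_continuous.
Qed.

Lemma net_profitE nu v : net_profit Psi c nu v = c - total_premium nu - retained v.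
Proof.
rewrite /net_profit -addrA -opprD; congr (_ - _).
by rewrite -big_split/=; apply: eq_bigr => i _; rewrite addrA.
Qed.

Section one_coupling.
Variable nu : probability (borel_rV R (n + n)) R.
Hypothesis nuX : dominated_coupling X nu.

Lemma total_premium_ge0 : 0 <= total_premium nu.
Proof.
apply: sumr_ge0 => i _; apply: Psi_ge0 => j.
rewrite mxE (coupling_momentE i nuX).
by apply: Rintegral_ge0 => v _; exact: zpow_ge0.
Qed.

(** The restriction to the event L <= c disappears because this event has
    probability 1: the premiums are nonnegative and z <= x. *)
Lemma expected_utilityE : expected_utility Psi c U nu =
  ((U c)%:E - \int[nu]_v (disutility c U (c - total_premium nu - retained v))%:E)%E.
Proof.
have cdis : continuous (fun v => disutility c U (c - total_premium nu - retained v)).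
  apply: continuous_compr; last exact: disutility_continuous.
  apply: continuous_subr; first exact: cst_continuous.
  exact: retained_continuous.
have mdis := continuous_measurable_R cdis.
rewrite -integral_cstB//; last by move=> v; exact: disutility_ge0.
have mD : measurable [set v : borel_rV R (n + n) | net_profit Psi c nu v <= c].
  rewrite (_ : [set v : borel_rV R (n + n) | _] =
      (fun v => c - total_premium nu - retained v) @^-1` `]-oo, c]%classic).
    rewrite -[X in measurable X]setTI; apply: continuous_measurable_R => //.
    apply: continuous_subr; first exact: cst_continuous.
    exact: retained_continuous.
  by apply/seteqP; split=> v /=; rewrite net_profitE in_itv.
rewrite /expected_utility integral_mkcond; apply: ae_eq_integral => //.
- apply/(measurable_restrictT _ mD).
  apply: (eq_measurable_fun
      (fun v : borel_rV R (n + n) => (U c - disutility c U (c - total_premium nu - retained v))%:E)).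
    move=> v; rewrite inE/= => le_c.
    by rewrite -net_profitE /disutility /Uext subKr (min_idPl le_c).
  by apply: measurable_funTS; apply/measurable_EFinP; exact: measurable_funB.
- by apply/measurable_EFinP; apply: measurable_funB.
have H : {ae nu, forall v : borel_rV R (n + n), setT v ->
   ((fun v => (U (net_profit Psi c nu v))%:E) \_ [set v | net_profit Psi c nu v <= c]) v =
   (U c - disutility c U (c - total_premium nu - retained v))%:E}.
  apply: filterS nuX.2 => v zx _.
  have le_c : net_profit Psi c nu v <= c.
    rewrite net_profitE -addrA gerDl -opprD oppr_le0 addr_ge0 ?total_premium_ge0//.
    by apply: sumr_ge0 => i _; rewrite subr_ge0; have /andP[] := zx i.
  rewrite patchE ifT ?inE//= -net_profitE /disutility /Uext subKr.
  by rewrite (min_idPl le_c).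
exact: H.
Qed.

End one_coupling.

(** The moment vectors stay in the set where Psi_i is continuous. *)
Lemma total_premium_cvg (A : set (borel_proba R (n + n))) (nu : borel_proba R (n + n)) :
  (forall mu, A mu -> dominated_coupling X mu) -> A nu ->
  (fun mu : borel_proba R (n + n) => total_premium mu) @ within A (nbhs nu)
     --> total_premium nu.
Proof.
move=> AX Anu; apply: cvg_sumr => i.
have mc mu : A mu -> (@moment_cone R (k i) `|` @moment_diag R (k i)) (moments (k i) i mu).
  by move=> /AX muX; exact: (moments_cone_or_diag X_ge0 (X_lty i) muX).
have cPsi := (subspace_continuousP _ _).1 (@Psi_cont i) _ (mc _ Anu).
move=> B nB; have nPsi := cPsi _ nB.
have nM : nbhs nu [set mu : borel_proba R (n + n) | A mu ->
    (@moment_cone R (k i) `|` @moment_diag R (k i)) (moments (k i) i mu) ->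
    B (Psi (moments (k i) i mu))].
  exact: (@moments_cvg _ _ _ _ _ _ X_ge0 i (k i) (X_lty i) A nu AX Anu _ nPsi).
by apply: filterS nM => mu muB Amu; exact: (muB Amu (mc mu Amu)).
Qed.

(** Outside of A the points of the subspace A are isolated. At nu in A, the
    function f N is a bounded continuous minorant of the disutility of every mu
    whose premium exceeds that of nu minus 1 / (N + 1), and the integrals of f N
    under nu increase to the full disutility of nu. *)
Lemma expected_utility_usc (A : set (borel_proba R (n + n))) :
  (forall mu, A mu -> dominated_coupling X mu) ->
  upper_semicontinuous (expected_utility Psi c U : subspace A -> \bar R).
Proof.
move=> AX nu a; have [Anu|nAnu] := pselect (A nu); last first.
  move=> nua; exists [set nu]; last by move=> _ ->.
  have : @nbhs_subspace (borel_proba R (n + n)) A nu [set nu].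
    by rewrite -(@nbhs_subspace_out (borel_proba R (n + n)) A nu nAnu) => _ ->.
  exact.
have nuX := AX _ Anu.
rewrite (expected_utilityE nuX).
set D := disutility c U; set y0 := c - total_premium nu.
set I0 := (\int[nu]_v _)%E => I0a; pose b := U c - a.
have D0 y : 0 <= D y := disutility_ge0 Umono y.
have cD : continuous D := disutility_continuous Uconc Umono.
have bI0 : (b%:E < I0)%E.
  have : (0 <= I0)%E by apply: integral_ge0 => v _; rewrite lee_fin.
  move: I0a; case: I0 => [r| |]//; last by rewrite ltry.
  by rewrite -EFinN -EFinD !lte_fin /b => ? _; lra.
pose f (N : nat) (v : 'rV[R]_(n + n)) := Num.min (D (y0 + N.+1%:R^-1 - retained v)) N%:R.
have cf N : continuous (fun v => D (y0 + N.+1%:R^-1 - retained v)).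
  apply: continuous_compr => //; apply: continuous_subr; first exact: cst_continuous.
  exact: retained_continuous.
have bf N : bcont (f N).
  apply: (@bcont_btw _ _ _ 0 N%:R).
    by apply: continuous_minr => //; exact: cst_continuous.
  by move=> v; rewrite le_min D0 ler0n ge_min lexx orbT.
have fI0 : (\int[nu]_v (f N v)%:E)%E @[N --> \oo] --> I0.
  have -> : I0 = (\int[nu]_v limn (fun N => (f N v)%:E))%E.
    apply: eq_integral => v _; apply/esym/cvg_lim => //.
    have cvD : D (y0 + N.+1%:R^-1 - retained v) @[N --> \oo] --> D (y0 - retained v).
      apply: (continuous_cvg _ (cD _)).
      apply: cvgB; last exact: cvg_cst.
      rewrite -[X in _ --> X]addr0; apply: cvgD; first exact: cvg_cst.
      exact: cvg_harmonic.
    apply: cvg_EFin; first exact: nearW.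
    apply: cvg_trans cvD; apply: near_eq_cvg; exists (Num.truncn (D (y0 - retained v))).+1 => // N /= DN.
    rewrite /f; apply/esym/min_idPl.
    apply: (@le_trans _ _ (D (y0 - retained v))).
      by apply: disutility_nonincreasing => //; rewrite lerD2r lerDl invr_ge0.
    by apply/ltW/(lt_le_trans (truncnS_gt _)); rewrite ler_nat.
  apply: cvg_monotone_convergence => //.
  - move=> N; apply/measurable_EFinP; apply: continuous_measurable_R.
    by case: (bf N).
  - by move=> N v _; rewrite lee_fin le_min D0 ler0n.
  - move=> v _ M N MN; rewrite lee_fin /f le_min !ge_min ler_nat MN orbT andbT.
    apply/orP; left; apply: disutility_nonincreasing => //.
    by rewrite lerD2r lerD2l lef_pV2 ?posrE// ler_nat.
have [N bN] : exists N, b < bint nu (f N).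
  apply: contrapT => nN; move: bI0; rewrite ltNge => /negP; apply.
  rewrite -(cvg_lim _ fI0)//; apply: lime_le; first by apply/cvg_ex; exists I0.
  apply: nearW => N; rewrite (bintE _ (bf N)) lee_fin leNgt.
  by apply/negP => bN; apply: nN; exists N.
have N0 : 0 < N.+1%:R^-1 :> R by rewrite invr_gt0.
pose V : set (borel_proba R (n + n)) := [set mu |
  A mu /\ (total_premium nu - N.+1%:R^-1 < total_premium mu /\ b < bint mu (f N))].
exists V.
  suff : @nbhs_subspace (borel_proba R (n + n)) A nu V by exact.
  rewrite -(@nbhs_subspace_in (borel_proba R (n + n)) A nu Anu).
  have n1 : within A (nbhs (nu : borel_proba R (n + n)))
      [set mu : borel_proba R (n + n) | total_premium nu - N.+1%:R^-1 < total_premium mu].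
    have lt1 : total_premium nu - N.+1%:R^-1 < total_premium nu by rewrite gtrBl.
    exact: (@total_premium_cvg A nu AX Anu _ (gt_nbhs lt1)).
  have n2 : nbhs (nu : borel_proba R (n + n)) [set mu | b < bint mu (f N)].
    exact: (bint_continuous (bf N) (gt_nbhs bN)).
  have n2' : within A (nbhs (nu : borel_proba R (n + n))) [set mu | b < bint mu (f N)].
    by apply: filterS n2 => mu.
  have n3 := withinT A (nbhs_filter (nu : borel_proba R (n + n))).
  exact: (filterI n3 (filterI n1 n2')).
move=> mu [Amu [pmu bmu]]; rewrite (expected_utilityE (AX _ Amu)).
set I1 := (\int[mu]_v _)%E.
have : (b%:E < I1)%E.
  apply: (@lt_le_trans _ _ (bint mu (f N))%:E); first by rewrite lte_fin.
  rewrite -bintE//; apply: ge0_le_integral => //.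
  - by move=> v _; rewrite lee_fin le_min D0 ler0n.
  - by apply/measurable_EFinP; apply: continuous_measurable_R; case: (bf N).
  - apply/measurable_EFinP; apply: continuous_measurable_R.
    apply: continuous_compr => //; apply: continuous_subr; first exact: cst_continuous.
    exact: retained_continuous.
  - move=> v _; rewrite lee_fin ge_min; apply/orP; left.
    by apply: disutility_nonincreasing => //; rewrite lerD2r /y0 -addrA lerD2l lerNl opprD opprK (ltW pmu).
by case: I1 => [r| |]//; rewrite ?ltNyr// -EFinN -EFinD !lte_fin /b => ?; lra.
Qed.

End expected_utility.

(** * Nonemptiness of H_X *)

Section conditional_probability.
Context d d' (T : measurableType d) (S : measurableType d') (R : realType)
  (nu : probability T R) (Y : {mfun T >-> S}).

Section image_of_restriction.
Variables (B : set T) (mB : measurable B).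

(** The law of Y on the event B; its density with respect to the law of Y is the
    conditional probability of B given Y. *)
Definition restricted_law : set S -> \bar R := pushforward (mrestr nu mB) Y.

Let restricted_law0 : restricted_law set0 = 0%E.
Proof. exact: measure0. Qed.

Let restricted_law_ge0 C : (0 <= restricted_law C)%E.
Proof. exact: measure_ge0. Qed.

Let restricted_law_sigma_additive : semi_sigma_additive restricted_law.
Proof. exact: measure_semi_sigma_additive. Qed.

HB.instance Definition _ := isMeasure.Build _ _ _ restricted_law
  restricted_law0 restricted_law_ge0 restricted_law_sigma_additive.

Lemma measurable_preimage (C : set S) : measurable C -> measurable (Y @^-1` C).
Proof. by move=> mC; rewrite -[X in measurable X]setTI; exact: measurable_funP. Qed.

Let restricted_law_fin : fin_num_fun restricted_law.
Proof.
move=> C mC; rewrite /restricted_law /pushforward /mrestr.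
rewrite ge0_fin_numE ?measure_ge0//.
have mYB : measurable (Y @^-1` C `&` B) by apply: measurableI => //; exact: measurable_preimage.
by apply: (@le_lt_trans _ _ 1%E); [exact: probability_le1|exact: ltry].
Qed.

HB.instance Definition _ := Measure_isFinite.Build _ _ _ restricted_law
  restricted_law_fin.

Lemma cond_prob_version_exists : exists g, cond_prob_version nu Y B g.
Proof.
pose Q := distribution nu Y.
have BQ : restricted_law `<< Q.
  apply/null_content_dominatesP => C mC QC0.
  apply/eqP; rewrite eq_le measure_ge0 andbT -QC0.
  rewrite /restricted_law /Q /distribution /pushforward /mrestr.
  apply: le_measure; rewrite ?inE//; last exact: measurable_preimage.
  by apply: measurableI => //; exact: measurable_preimage.
pose f := Radon_Nikodym_SigmaFinite.f restricted_law Q.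
have f0 := Radon_Nikodym_SigmaFinite.f_ge0 BQ.
have ffin := Radon_Nikodym_SigmaFinite.f_fin_num BQ.
have fI := Radon_Nikodym_SigmaFinite.f_integral BQ.
have mf : measurable_fun setT f.
  exact: measurable_int (Radon_Nikodym_SigmaFinite.f_integrable BQ).
have int_g C : measurable C ->
    (\int[nu]_(v in Y @^-1` C) (fine (f (Y v)))%:E = nu (B `&` Y @^-1` C))%E.
  move=> mC; transitivity (restricted_law C); last by rewrite setIC.
  rewrite (fI C mC) [RHS](ge0_integral_pushforward (measurable_funP Y))//.
  - by apply: eq_integral => v _; rewrite /= fineK// ffin.
  - exact: measurable_funTS.
have mg : measurable_fun setT (fun x => fine (f x)).
  by apply: measurableT_comp mf; exact: fine_measurable.
exists (fun v => fine (f (Y v))); split.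
- move=> C mC; exists ((fun x => fine (f x)) @^-1` C).
    by rewrite -[X in measurable X]setTI; exact: mg.
  by rewrite setTI.
- apply/integrableP; split.
    by apply/measurable_EFinP; apply: (measurableT_comp mg); exact: measurable_funP.
  under eq_integral do rewrite /= ger0_norm ?fine_ge0 ?f0//.
  have := int_g setT measurableT; rewrite preimage_setT => ->.
  by rewrite setIT (le_lt_trans (probability_le1 _ mB))// ltry.
- by move=> _ [C mC <-]; rewrite setTI int_g.
Qed.

End image_of_restriction.

End conditional_probability.

Lemma ae_setI_measure d (T : measurableType d) (R : realType)
    (nu : probability T R) (A B : set T) :
  measurable A -> measurable B -> {ae nu, forall v, A v} -> nu (A `&` B) = nu B.
Proof.
move=> mA mB [N [mN N0 AN]].
have BA0 : nu (B `\` A) = 0%E.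
  apply: (@subset_measure0 _ _ _ nu _ N) => //; first exact: measurableD.
  by move=> v [_ nAv]; exact: AN.
by rewrite (measureDI nu mB mA) [X in (X + _)%E]BA0 add0e setIC.
Qed.

(** An event in sigma(Z) has probability 0 or 1, so its conditional probability
    is the constant 0 or 1, and intersecting with it keeps B or yields a null
    event. *)
Lemma ae_cst_cond_indep d d1 d2 d3 (T : measurableType d)
    (S1 : measurableType d1) (S2 : measurableType d2) (S3 : measurableType d3)
    (R : realType) (nu : probability T R)
    (Z : {mfun T >-> S1}) (W : {mfun T >-> S2}) (Y : {mfun T >-> S3}) (z : S1) :
  {ae nu, forall v, Z v = z} -> cond_indep nu Z W Y.
Proof.
move=> Zz _ _ [C mC <-] [D mD <-]; rewrite !setTI.
have mZC := measurable_preimage Z mC; have mWD := measurable_preimage W mD.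
have [q qv] := cond_prob_version_exists nu Y mWD.
have [qm qi qE] := qv.
have mY E : g_sigma_algebra_preimage Y E -> measurable E.
  by move=> [F mF <-]; rewrite setTI; exact: measurable_preimage.
have cst_version (a : R) : (forall E, measurable E -> (nu (Z @^-1` C `&` E) = a%:E * nu E)%E) ->
    cond_prob_version nu Y (Z @^-1` C) (fun=> a).
  move=> aE; split.
  - move=> F mF; rewrite /preimage/=; have [Fa|nFa] := pselect (F a).
      by exists setT => //; rewrite setTI; apply/seteqP; split.
    by exists set0 => //; rewrite setTI; apply/seteqP; split.
  - exact: finite_measure_integrable_cst.
  - by move=> E /mY mE; rewrite integral_cst// aE.
have [Cz|nCz] := pselect (C z).
  have aeC : {ae nu, forall v, (Z @^-1` C) v} by apply: filterS Zz => v /= ->.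
  exists (fun=> 1), q, q; split=> //.
  - by apply: cst_version => E mE; rewrite ae_setI_measure// mul1e.
  - split=> // E YE; rewrite qE// -setIA [RHS]ae_setI_measure//.
    by apply: measurableI => //; exact: mY.
  - by apply: nearW => v; rewrite mul1r.
have aeC : {ae nu, forall v, (~` (Z @^-1` C)) v} by apply: filterS Zz => v /= ->.
have Cnull E : measurable E -> nu (Z @^-1` C `&` E) = 0%E.
  move=> mE; rewrite -(ae_setI_measure (measurableC mZC) _ aeC); last exact: measurableI.
  by rewrite setIA setICl set0I measure0.
exists (fun=> 0), q, (fun=> 0); split=> //.
- by apply: cst_version => E mE; rewrite Cnull// mul0e.
- have [m0 i0 E0] : cond_prob_version nu Y (Z @^-1` C) (fun=> 0).
    by apply: cst_version => E mE; rewrite Cnull// mul0e.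
  split=> // E YE; rewrite E0// -setIA !Cnull//; last exact: mY.
  by apply: measurableI => //; exact: mY.
- by apply: nearW => v; rewrite mul0r.
Qed.

Section no_insurance.
Context (R : realType) (n : nat) (d : measure_display) (Omega : measurableType d)
  (P : probability Omega R) (X : {RV P >-> borel_rV R n}).
Hypothesis X_ge0 : forall w i, 0 <= (X w : 'rV[R]_n) ord0 i.

Definition with_zero (w : Omega) : borel_rV R (n + n) :=
  row_mx (X w : 'rV[R]_n) (0 : 'rV[R]_n).

Lemma measurable_with_zero : measurable_fun setT with_zero.
Proof.
have c0 : continuous (fun x : 'rV[R]_n => row_mx x (0 : 'rV[R]_n)).
  apply: continuous_rV => j; rewrite -[j]splitK; case: (fintype.split j) => l /=.
    by under eq_fun do rewrite row_mxEl; exact: coord_continuous.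
  by under eq_fun do rewrite row_mxEr mxE; exact: cst_continuous.
have := continuous_measurable_rV c0.
by move=> /measurableT_comp; apply; exact: measurable_funP.
Qed.

HB.instance Definition _ := isMeasurableFun.Build _ _ _ _ _ measurable_with_zero.

Lemma xpart_with_zero w : xpart (with_zero w) = X w.
Proof. by rewrite /xpart /with_zero row_mxKl. Qed.

Lemma zcoord_with_zero i w : zcoord i (with_zero w) = 0.
Proof. by rewrite /zcoord /zpart /with_zero row_mxKr mxE. Qed.

HB.instance Definition _ i := isMeasurableFun.Build _ _ _ _ _ (@measurable_xcoord R n i).
HB.instance Definition _ i := isMeasurableFun.Build _ _ _ _ _ (@measurable_zcoord R n i).
HB.instance Definition _ i := isMeasurableFun.Build _ _ _ _ _ (@measurable_other_coords R n i).

(** The law of (X, 0), that is, no claim is ceded. *)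
Lemma HX_nonempty : HX (distribution P X) !=set0.
Proof.
pose nu : probability (borel_rV R (n + n)) R := distribution P with_zero.
exists nu; split.
- move=> A mA; rewrite /distribution /pushforward; congr (P _).
  by apply/seteqP; split=> w /=; rewrite xpart_with_zero.
- rewrite /distribution /pushforward -[RHS](probability_setT P); congr (P _).
  apply/seteqP; split=> // w _ i /=.
  by rewrite zcoord_with_zero lexx /xcoord xpart_with_zero X_ge0.
- move=> i.
  pose Zm : {mfun borel_rV R (n + n) >-> R} := zcoord i.
  pose Ym : {mfun borel_rV R (n + n) >-> R} := xcoord i.
  pose Wm : {mfun borel_rV R (n + n) >-> borel_rV R (n.-1 + n.-1)} := other_coords i.
  have Z0 : {ae nu, forall v, Zm v = 0}.
    exists (~` (Zm @^-1` [set 0])); split => [||v //].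
      by apply: measurableC; exact: measurable_preimage.
    rewrite /nu /distribution /pushforward -[RHS](measure0 P); congr (P _).
    by apply/seteqP; split=> // w /=; rewrite zcoord_with_zero.
  exact: (@ae_cst_cond_indep _ _ _ _ _ _ _ _ _ nu Zm Wm Ym 0 Z0).
Qed.

End no_insurance.

(** * Existence of an optimal contract *)

Theorem theorem3p7 (R : realType) (n : nat) (hn : (2 <= n)%N)
    (d : measure_display) (Omega : measurableType d) (P : probability Omega R)
    (X : {RV P >-> borel_rV R n})
    (hX : forall (w : Omega) (i : 'I_n), 0 <= (X w : 'rV[R]_n) ord0 i)
    (k : 'I_n -> nat) (hk : forall i, (1 <= k i)%N)
    (Psi : forall i : 'I_n, 'rV[R]_(k i) -> R)
    (hPsi : forall (i : 'I_n) (x : 'rV[R]_(k i)),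
      (forall j, 0 <= x ord0 j) -> 0 <= Psi i x)
    (c : R) (U : R -> R)
    (hUconc : concave_function (`]-oo, c]%classic) U)
    (hUmono : {in `]-oo, c] &, {homo U : x y / x <= y}})
    (hmom : forall i : 'I_n,
      ('E_P[fun w => ((X w : 'rV[R]_n) ord0 i ^+ k i)%R] < +oo)%E)
    (hcont : forall i : 'I_n,
      {within (@moment_cone R (k i)) `|` (@moment_diag R (k i)), continuous (Psi i)}) :
  let H := closure (HX (distribution P X)) in
  upper_semicontinuous (expected_utility Psi c U : subspace H -> \bar R) /\
  exists2 nu, H nu &
    forall nu', H nu' ->
      (expected_utility Psi c U nu' <= expected_utility Psi c U nu)%E.
Proof.
move=> H.
have Hdom mu : H mu -> dominated_coupling X mu by exact: HX_closure_dominated.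
have Xk_lty i : (\int[P]_w ((X w : 'rV[R]_n) ord0 i ^+ k i)%:E < +oo)%E.
  by have := hmom i; rewrite unlock.
have X_lty i : (\int[P]_w ((X w : 'rV[R]_n) ord0 i)%:E < +oo)%E.
  by have := Xpow_lty hX (Xk_lty i) (hk i); under eq_integral do rewrite expr1.
have usc := expected_utility_usc hX Xk_lty hPsi hcont hUconc hUmono Hdom.
split; first exact: usc.
apply: usc_compact_max => //.
- apply: uniformly_tight_compact; first exact: closed_closure.
  exact: (dominated_uniformly_tight hX X_lty).
- have [nu HXnu] := HX_nonempty hX.
  by exists nu; exact: subset_closure.
Qed.
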